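(* Let $(A,\phi_0,P,N)$ be a Jacobi-Nijenhuis algebroid. Then the bivectors $N^kP$, $k\ge 0$, form a hierarchy of pairwise compatible Jacobi bivectors on $(A,\phi_0)$: $$[N^iP,N^jP]^{\phi_0}=0\qquad\text{for all integers } i,j\ge 0.$$
   Context: A Jacobi algebroid $(A,\phi_0)$ is a Lie algebroid $(A,[\cdot,\cdot],\rho)$ over $M$ with a 1-cocycle $\phi_0\in\Gamma(A^* )$ ($\mathrm d\phi_0=0$). The Schouten bracket on $\Gamma(\wedge^\bullet A)$ extends the Lie bracket with $[X,f]=\rho(X)f$, $[P,Q]=-(-1)^{(p-1)(q-1)}[Q,P]$, $[P,Q\wedge R]=[P,Q]\wedge R+(-1)^{(p-1)q}Q\wedge[P,R]$. The Schouten-Jacobi bracket is $[P,Q]^{\phi_0}=[P,Q]+(p-1)P\wedge i_{\phi_0}Q-(-1)^{p-1}(q-1)\,i_{\phi_0}P\wedge Q$ for $P\in\Gamma(\wedge^pA)$, $Q\in\Gamma(\wedge^qA)$. For a bivector $P$, $P^\sharp:A^*\to A$ is given by $\langle\beta,P^\sharp\alpha\rangle=P(\alpha,\beta)$. A Jacobi bivector is $P\in\Gamma(\wedge^2A)$ with $[P,P]^{\phi_0}=0$; two Jacobi bivectors $P_1,P_2$ are compatible if $[P_1,P_2]^{\phi_0}=0$. The $\phi_0$-differential is $\mathrm d^{\phi_0}\omega=\mathrm d\omega+\phi_0\wedge\omega$ and for a section $X$ of $A$ the $\phi_0$-Lie derivative is $\mathcal L^{\phi_0}_X=i_X\mathrm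 d^{\phi_0}+\mathrm d^{\phi_0}i_X$. A bivector $Q$ on a Jacobi algebroid $(A,\phi_0)$ defines the bracket on $\Gamma(A^* )$: $[\alpha,\beta]_Q=\mathcal L^{\phi_0}_{Q^\sharp\alpha}\beta-\mathcal L^{\phi_0}_{Q^\sharp\beta}\alpha-\mathrm d^{\phi_0}(Q(\alpha,\beta))$. A Nijenhuis operator is a bundle map $N:A\to A$ over the identity with $[NX,NY]=N[X,Y]_N$, where $[X,Y]_N=[NX,Y]+[X,NY]-N[X,Y]$; then $A_N=(A,[\cdot,\cdot]_N,\rho\circ N)$ is a Lie algebroid and $\phi_1=N^*\phi_0$ is a 1-cocycle of it. A Jacobi-Nijenhuis algebroid $(A,\phi_0,P,N)$ is a Jacobi algebroid $(A,\phi_0)$ with a Jacobi bivector $P$ and a Nijenhuis operator $N$ that are compatible: (1) $N\circ P^\sharp=P^\sharp\circ N^*$ (so $NP$, defined by $(NP)^\sharp=N\circ P^\sharp$, is a bivector); (2) the bracket $[\cdot,\cdot]_{NP}$ on $\Gamma(A^* )$ defined by $NP$ on $(A,\phi_0)$ equals the bracket $[\cdot,\cdot]_P^N$ on $\Gamma(A^* )$ defined by the bivector $P$ on $(A_N,\phi_1)$. The bivector $N^kP$ is defined by $(N^kP)^\sharp=N^k\circ P^\sharp$. *)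

(* Defs.v *)
From HB Require Import structures.
From mathcomp Require Import all_boot all_order all_algebra.
From mathcomp Require Import all_classical all_reals all_analysis.
Set Implicit Arguments. Unset Strict Implicit. Unset Printing Implicit Defensive.
Import Order.TTheory GRing.Theory Num.Theory.
Import numFieldNormedType.Exports.
Local Open Scope classical_set_scope.
Local Open Scope ring_scope.

(* Objects of the geometry (functions, sections, tensor fields) are total
   functions on M, and smoothness is a separate predicate.  Operations on
   sections are likewise total functions, whose values are constrained only at
   smooth arguments. *)

(** * Smooth functions on open subsets of R^n *)

(* All conditions are on germs at points of V, and V is always open below.  A
   function is C^(k+1) iff it is differentiable with C^k partial derivatives. *)
Fixpoint Ck (R : realType) (n k : nat) (V : set 'rV[R]_n) (f : 'rV[R]_n -> R)
    : Prop :=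
  if k is k'.+1 then
    (forall y, V y -> differentiable f y) /\
    (forall i : 'I_n, Ck k' V (fun y => 'D_(delta_mx 0 i) f y))
  else forall y, V y -> {for y, continuous f}.

Definition Cinfty (R : realType) (n : nat) (V : set 'rV[R]_n)
    (f : 'rV[R]_n -> R) : Prop := forall k, Ck k V f.

(** * Smooth manifolds *)

(* cmap is meaningful on cdom only, cinv on cmap @` cdom only. *)
Record chart (R : realType) (n : nat) (M : topologicalType) := Chart {
  cdom : set M;
  cmap : M -> 'rV[R]_n;
  cinv : 'rV[R]_n -> M }.

Record is_chart (R : realType) (n : nat) (M : topologicalType)
    (c : chart R n M) : Prop := IsChart {
  cdom_open : open (cdom c);
  cimg_open : open (cmap c @` cdom c);
  cmapK : forall x, cdom c x -> cinv c (cmap c x) = x;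
  cmap_cont : forall x, cdom c x -> {for x, continuous (cmap c)};
  cinv_cont : forall y, (cmap c @` cdom c) y -> {for y, continuous (cinv c)} }.

Record manifold (R : realType) (n : nat) := Manifold {
  mspace :> topologicalType;
  atlas : set (chart R n mspace);
  mspace_hausdorff : hausdorff_space mspace;
  mspace_countable : @second_countable mspace;
  atlas_chart : forall c, atlas c -> is_chart c;
  atlas_cover : forall x, exists2 c, atlas c & cdom c x;
  atlas_compat : forall c1 c2, atlas c1 -> atlas c2 -> forall i : 'I_n,
    Cinfty (cmap c1 @` (cdom c1 `&` cdom c2))
           (fun y => cmap c2 (cinv c1 y) 0 i) }.

Definition smooth_on (R : realType) (n : nat) (M : manifold R n) (U : set M)
    (f : M -> R) : Prop :=
  forall c, atlas c -> Cinfty (cmap c @` (cdom c `&` U)) (fun y => f (cinv c y)).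

Definition smooth (R : realType) (n : nat) (M : manifold R n) (f : M -> R) :=
  smooth_on setT f.

(** * Vector bundles *)

Record lframe (R : realType) (M : Type) (r : nat) (E : M -> vectType R) :=
  LFrame {
    fdom : set M;
    fvec : forall x, r.-tuple (E x) }.

(* A family of vector spaces, with its smooth structure given by a covering by
   local frames whose transition matrices are smooth. *)
Record vbundle (R : realType) (n : nat) (M : manifold R n) (r : nat) :=
  VBundle {
    fiber :> M -> vectType R;
    frames : set (lframe r fiber);
    frames_open : forall F, frames F -> open (fdom F);
    frames_cover : forall x, exists2 F, frames F & fdom F x;
    frames_basis : forall F, frames F -> forall x, fdom F x ->
      basis_of fullv (fvec F x);
    frames_compat : forall F G, frames F -> frames G -> forall i j : 'I_r,
      smooth_on (fdom F `&` fdom G)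
                (fun x => coord (fvec G x) j (tnth (fvec F x) i)) }.

Definition section (R : realType) (n : nat) (M : manifold R n) (r : nat)
    (A : vbundle M r) := forall x : M, A x.

Definition smooth_section (R : realType) (n : nat) (M : manifold R n) (r : nat)
    (A : vbundle M r) (X : section A) : Prop :=
  forall F, frames F -> forall i : 'I_r,
    smooth_on (fdom F) (fun x => coord (fvec F x) i (X x)).

Definition cosection (R : realType) (n : nat) (M : manifold R n) (r : nat)
    (A : vbundle M r) := forall x : M, 'Hom(A x, R^o).

Definition smooth_cosection (R : realType) (n : nat) (M : manifold R n)
    (r : nat) (A : vbundle M r) (al : cosection A) : Prop :=
  forall X : section A, smooth_section X -> smooth (fun x => al x (X x)).

Definition endo (R : realType) (n : nat) (M : manifold R n) (r : nat)
    (A : vbundle M r) := forall x : M, 'End(A x).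

Definition smooth_endo (R : realType) (n : nat) (M : manifold R n) (r : nat)
    (A : vbundle M r) (N : endo A) : Prop :=
  forall X : section A, smooth_section X ->
    smooth_section (fun x => N x (X x) : A x).

(** * Exterior algebra of a finite-dimensional space *)

(* A multivector on V is a function of a list of covectors; it lies in the p-th
   exterior power if it is supported on lists of length p, where it is an
   alternating multilinear form.  Grading the arguments by the length of the
   list avoids casts between degrees. *)
Definition mvec (R : realType) (V : vectType R) := seq 'Hom(V, R^o) -> R.

Record pvector (R : realType) (V : vectType R) (p : nat) (P : mvec V) : Prop :=
  PVector {
    pvector_size : forall s, size s != p -> P s = 0;
    pvector_lin : forall s t (c : R) (a b : 'Hom(V, R^o)),
      P (s ++ (c *: a + b) :: t) = c * P (s ++ a :: t) + P (s ++ b :: t);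
    pvector_alt : forall s, ~~ uniq s -> P s = 0 }.

(* Number of pairs i < j with m_i = false and m_j = true: the number of
   inversions of the shuffle listing first the positions selected by m, then
   the others. *)
Fixpoint ninv (m : bitseq) : nat :=
  if m is b :: m' then ((if b then 0 else count id m') + ninv m')%N else 0%N.

(* Normalised without factorials:
   (u /\ v)(a, b) = a(u) b(v) - b(u) a(v) for vectors u and v. *)
Definition wedge (R : realType) (V : vectType R) (P Q : mvec V) : mvec V :=
  fun s => \sum_(m : (size s).-tuple bool)
    (-1) ^+ ninv m * P (mask m s) * Q (mask (map negb m) s).

Definition iprod (R : realType) (V : vectType R) (a : 'Hom(V, R^o))
    (P : mvec V) : mvec V := fun s => P (a :: s).

Definition dual_vbasis (R : realType) (V : vectType R)
    (i : 'I_(\dim {: V}%VS)) : 'Hom(V, R^o) :=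
  linfun (coord (vbasis {: V}%VS) i : V -> R^o).

(* For a bivector P, the vector (sharp P a) is characterised by sharpE. *)
Definition sharp (R : realType) (V : vectType R) (P : mvec V)
    (a : 'Hom(V, R^o)) : V :=
  \sum_(i < \dim {: V}%VS)
    P [:: a; dual_vbasis i] *: tnth (vbasis {: V}%VS) i.

Lemma dual_vbasis_sum (R : realType) (V : vectType R) (b : 'Hom(V, R^o)) :
  b = \sum_(i < \dim {: V}%VS) b (tnth (vbasis {: V}%VS) i) *: dual_vbasis i.
Proof.
apply/lfunP => v; rewrite sum_lfunE.
rewrite {1}(coord_vbasis (memvf v)) linear_sum /=; apply: eq_bigr => i _.
by rewrite linearZ /= scale_lfunE lfunE /= (tnth_nth 0) /GRing.scale /= mulrC.
Qed.

Lemma sharpE (R : realType) (V : vectType R) (P : mvec V) :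
  pvector 2 P -> forall a b : 'Hom(V, R^o), b (sharp P a) = P [:: a; b].
Proof.
move=> hP a b; rewrite {2}(dual_vbasis_sum b) linear_sum /=.
have add0 c d : P [:: a; c + d] = P [:: a; c] + P [:: a; d].
  by have := pvector_lin hP [:: a] [::] 1 c d; rewrite scale1r mul1r.
have z0 : P [:: a; 0] = 0.
  by apply: (addrI (P [:: a; 0])); rewrite -add0 !addr0.
have hZ c d : P [:: a; c *: d] = c * P [:: a; d].
  by have := pvector_lin hP [:: a] [::] c d 0; rewrite /= z0 !addr0.
rewrite (big_morph (fun c => P [:: a; c]) add0 z0).
by apply: eq_bigr => i _; rewrite linearZ /= hZ mulrC.
Qed.

(** * Multivector fields: sections of the exterior powers of A *)

Definition mvfield (R : realType) (n : nat) (M : manifold R n) (r : nat)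
    (A : vbundle M r) := forall x : M, mvec (A x).

Definition pvfield (R : realType) (n : nat) (M : manifold R n) (r : nat)
    (A : vbundle M r) (p : nat) (P : mvfield A) : Prop :=
  (forall x, pvector p (P x)) /\
  (forall al : 'I_p -> cosection A, (forall i, smooth_cosection (al i)) ->
    smooth (fun x => P x [seq al i x | i <- enum 'I_p])).

Definition mv_of_fun (R : realType) (n : nat) (M : manifold R n) (r : nat)
    (A : vbundle M r) (f : M -> R) : mvfield A :=
  fun x s => if s is [::] then f x else 0.
Arguments mv_of_fun {R n M r} A f.

Definition mv_of_section (R : realType) (n : nat) (M : manifold R n) (r : nat)
    (A : vbundle M r) (X : section A) : mvfield A :=
  fun x s => if s is [:: a] then a (X x) else 0.
Arguments mv_of_section {R n M r A} X.

(** * Lie algebroids *)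

(* Tangent vectors at x are derivations at x of the algebra of smooth
   functions, so that anchor x v f is the derivative of f along rho(v). *)
Record algebroid_data (R : realType) (n : nat) (M : manifold R n) (r : nat)
    (A : vbundle M r) := AlgebroidData {
  bracket : section A -> section A -> section A;
  anchor : forall x : M, A x -> (M -> R) -> R }.

Record is_lie_algebroid (R : realType) (n : nat) (M : manifold R n) (r : nat)
    (A : vbundle M r) (D : algebroid_data A) : Prop := IsLieAlgebroid {
  anchor_lin : forall x (c : R) (u v : A x) f, smooth f ->
    anchor D (c *: u + v) f = c * anchor D u f + anchor D v f;
  anchor_linf : forall x (v : A x) (c : R) f g, smooth f -> smooth g ->
    anchor D v (fun y => c * f y + g y) = c * anchor D v f + anchor D v g;
  anchor_der : forall x (v : A x) f g, smooth f -> smooth g ->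
    anchor D v (fun y => f y * g y) = f x * anchor D v g + g x * anchor D v f;
  anchor_smooth : forall (X : section A) f, smooth_section X -> smooth f ->
    smooth (fun x => anchor D (X x) f);
  bracket_smooth : forall X Y, smooth_section X -> smooth_section Y ->
    smooth_section (bracket D X Y);
  bracket_lin : forall (c : R) X Y Z,
    smooth_section X -> smooth_section Y -> smooth_section Z ->
    forall x, bracket D (fun y => c *: X y + Y y) Z x =
              c *: bracket D X Z x + bracket D Y Z x;
  bracket_skew : forall X Y, smooth_section X -> smooth_section Y ->
    forall x, bracket D X Y x = - bracket D Y X x;
  bracket_jacobi : forall X Y Z,
    smooth_section X -> smooth_section Y -> smooth_section Z ->
    forall x, bracket D X (bracket D Y Z) x + bracket D Y (bracket D Z X) x
              + bracket D Z (bracket D X Y) x = 0;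
  bracket_leibniz : forall X Y f,
    smooth_section X -> smooth_section Y -> smooth f ->
    forall x, bracket D X (fun y => f y *: Y y) x =
              f x *: bracket D X Y x + anchor D (X x) f *: Y x;
  anchor_bracket : forall X Y f,
    smooth_section X -> smooth_section Y -> smooth f ->
    forall x, anchor D (bracket D X Y x) f =
              anchor D (X x) (fun y => anchor D (Y y) f)
              - anchor D (Y x) (fun y => anchor D (X y) f) }.

Record lie_algebroid (R : realType) (n : nat) (M : manifold R n) (r : nat)
    (A : vbundle M r) := LieAlgebroid {
  la_data :> algebroid_data A;
  la_axioms : is_lie_algebroid la_data }.

(** * Differential calculus, in degrees at most 2 *)

(* Forms are evaluated on sections of A.  The operators depend only on the
   bracket and the anchor, so that they also apply to the deformed algebroid. *)
Definition dfun (R : realType) (n : nat) (M : manifold R n) (r : nat)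
    (A : vbundle M r) (D : algebroid_data A) (f : M -> R) (X : section A)
    : M -> R :=
  fun x => anchor D (X x) f.

Definition dform (R : realType) (n : nat) (M : manifold R n) (r : nat)
    (A : vbundle M r) (D : algebroid_data A) (al : cosection A)
    (X Y : section A) : M -> R :=
  fun x => anchor D (X x) (fun y => al y (Y y))
           - anchor D (Y x) (fun y => al y (X y))
           - al x (bracket D X Y x).

Definition is_cocycle (R : realType) (n : nat) (M : manifold R n) (r : nat)
    (A : vbundle M r) (D : algebroid_data A) (phi : cosection A) : Prop :=
  smooth_cosection phi /\
  forall X Y, smooth_section X -> smooth_section Y ->
    forall x, dform D phi X Y x = 0.

Definition dphi_fun (R : realType) (n : nat) (M : manifold R n) (r : nat)
    (A : vbundle M r) (D : algebroid_data A) (phi : cosection A)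
    (f : M -> R) (X : section A) : M -> R :=
  fun x => dfun D f X x + f x * phi x (X x).

Definition dphi_form (R : realType) (n : nat) (M : manifold R n) (r : nat)
    (A : vbundle M r) (D : algebroid_data A) (phi : cosection A)
    (al : cosection A) (X Y : section A) : M -> R :=
  fun x => dform D al X Y x
           + (phi x (X x) * al x (Y x) - phi x (Y x) * al x (X x)).

Definition lie_phi (R : realType) (n : nat) (M : manifold R n) (r : nat)
    (A : vbundle M r) (D : algebroid_data A) (phi : cosection A)
    (X : section A) (al : cosection A) (Z : section A) : M -> R :=
  fun x => dphi_form D phi al X Z x
           + dphi_fun D phi (fun y => al y (X y)) Z x.

Definition sharp_field (R : realType) (n : nat) (M : manifold R n) (r : nat)
    (A : vbundle M r) (Q : mvfield A) (al : cosection A) : section A :=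
  fun x => sharp (Q x) (al x).
Arguments sharp_field {R n M r A} Q al.

(* The value on Z of the section [al, be]_Q of the dual of A. *)
Definition bivector_bracket (R : realType) (n : nat) (M : manifold R n)
    (r : nat) (A : vbundle M r) (D : algebroid_data A) (phi : cosection A)
    (Q : mvfield A) (al be : cosection A) (Z : section A) : M -> R :=
  fun x => lie_phi D phi (sharp_field Q al) be Z x
           - lie_phi D phi (sharp_field Q be) al Z x
           - dphi_fun D phi (fun y => Q y [:: al y; be y]) Z x.

(** * Schouten and Schouten-Jacobi brackets *)

(* sch is the Schouten bracket of D; it is determined on homogeneous smooth
   multivector fields by these rules.  In the signs the exponent p - 1 is
   replaced by p + 1, which has the same parity and makes sense for p = 0. *)
Record is_schouten (R : realType) (n : nat) (M : manifold R n) (r : nat)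
    (A : vbundle M r) (D : algebroid_data A)
    (sch : mvfield A -> mvfield A -> mvfield A) : Prop := IsSchouten {
  sch_degree : forall p q P Q, pvfield p P -> pvfield q Q -> (0 < p + q)%N ->
    pvfield (p + q).-1 (sch P Q);
  sch_fun_fun : forall f g, smooth f -> smooth g ->
    forall x s, sch (mv_of_fun A f) (mv_of_fun A g) x s = 0;
  sch_section_fun : forall X f, smooth_section X -> smooth f ->
    forall x s, sch (mv_of_section X) (mv_of_fun A f) x s =
                mv_of_fun A (fun y => anchor D (X y) f) x s;
  sch_section_section : forall X Y, smooth_section X -> smooth_section Y ->
    forall x s, sch (mv_of_section X) (mv_of_section Y) x s =
                mv_of_section (bracket D X Y) x s;
  sch_lin : forall p q P Q Q' (c : R),
    pvfield p P -> pvfield q Q -> pvfield q Q' ->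
    forall x s, sch P (fun y t => c * Q y t + Q' y t) x s =
                c * sch P Q x s + sch P Q' x s;
  sch_skew : forall p q P Q, pvfield p P -> pvfield q Q ->
    forall x s, sch P Q x s = - ((-1) ^+ (p.+1 * q.+1) * sch Q P x s);
  sch_leibniz : forall p q k P Q S, pvfield p P -> pvfield q Q -> pvfield k S ->
    forall x s, sch P (fun y => wedge (Q y) (S y)) x s =
                wedge (sch P Q x) (S x) s
                + (-1) ^+ (p.+1 * q) * wedge (Q x) (sch P S x) s }.

Definition schouten_jacobi (R : realType) (n : nat) (M : manifold R n)
    (r : nat) (A : vbundle M r) (sch : mvfield A -> mvfield A -> mvfield A)
    (phi : cosection A) (p q : nat) (P Q : mvfield A) : mvfield A :=
  fun x s => sch P Q x s
             + (p%:R - 1) * wedge (P x) (iprod (phi x) (Q x)) s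
             - (-1) ^+ p.+1 * (q%:R - 1) * wedge (iprod (phi x) (P x)) (Q x) s.
Arguments schouten_jacobi {R n M r A} sch phi p q P Q.

Definition jacobi_bivector (R : realType) (n : nat) (M : manifold R n)
    (r : nat) (A : vbundle M r) (sch : mvfield A -> mvfield A -> mvfield A)
    (phi : cosection A) (P : mvfield A) : Prop :=
  pvfield 2 P /\ forall x s, schouten_jacobi sch phi 2 2 P P x s = 0.

Definition compatible_bivectors (R : realType) (n : nat) (M : manifold R n)
    (r : nat) (A : vbundle M r) (sch : mvfield A -> mvfield A -> mvfield A)
    (phi : cosection A) (P1 P2 : mvfield A) : Prop :=
  forall x s, schouten_jacobi sch phi 2 2 P1 P2 x s = 0.

(** * Nijenhuis operators and Jacobi-Nijenhuis algebroids *)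

Definition app_endo (R : realType) (n : nat) (M : manifold R n) (r : nat)
    (A : vbundle M r) (N : endo A) (X : section A) : section A :=
  fun x => N x (X x).
Arguments app_endo {R n M r A} N X.

Definition coapp_endo (R : realType) (n : nat) (M : manifold R n) (r : nat)
    (A : vbundle M r) (N : endo A) (al : cosection A) : cosection A :=
  fun x => (al x \o N x)%VF.
Arguments coapp_endo {R n M r A} N al.

(* The bracket [., .]_N and the anchor rho o N of A_N. *)
Definition deformed (R : realType) (n : nat) (M : manifold R n) (r : nat)
    (A : vbundle M r) (D : algebroid_data A) (N : endo A) : algebroid_data A :=
  AlgebroidData
    (fun X Y x => bracket D (app_endo N X) Y x + bracket D X (app_endo N Y) x
                  - N x (bracket D X Y x))
    (fun x v f => anchor D (N x v) f).

Definition is_nijenhuis (R : realType) (n : nat) (M : manifold R n) (r : nat)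
    (A : vbundle M r) (D : algebroid_data A) (N : endo A) : Prop :=
  smooth_endo N /\
  forall X Y, smooth_section X -> smooth_section Y ->
    forall x, bracket D (app_endo N X) (app_endo N Y) x =
              N x (bracket (deformed D N) X Y x).

(* N^k P, that is (N^k P)(a, b) = b (N^k (sharp P a)). *)
Definition iter_bivector (R : realType) (n : nat) (M : manifold R n) (r : nat)
    (A : vbundle M r) (N : endo A) (k : nat) (P : mvfield A) : mvfield A :=
  fun x s => if s is [:: a; b] then b (iter k (N x) (sharp (P x) a)) else 0.
Arguments iter_bivector {R n M r A} N k P.

Record is_jacobi_nijenhuis (R : realType) (n : nat) (M : manifold R n)
    (r : nat) (A : vbundle M r) (D : lie_algebroid A)
    (sch : mvfield A -> mvfield A -> mvfield A) (phi0 : cosection A)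
    (P : mvfield A) (N : endo A) : Prop := IsJacobiNijenhuis {
  jn_cocycle : is_cocycle D phi0;
  jn_bivector : jacobi_bivector sch phi0 P;
  jn_nijenhuis : is_nijenhuis D N;
  jn_sharp : forall x (a : 'Hom(A x, R^o)),
    N x (sharp (P x) a) = sharp (P x) (a \o N x)%VF;
  jn_bracket : forall al be Z,
    smooth_cosection al -> smooth_cosection be -> smooth_section Z ->
    forall x, bivector_bracket D phi0 (iter_bivector N 1 P) al be Z x =
      bivector_bracket (deformed D N) (coapp_endo N phi0) P al be Z x }.

(* Main.v *)
Require Import Defs.
From mathcomp Require Import all_boot all_order all_algebra.
From mathcomp Require Import all_classical all_reals all_analysis.
From mathcomp Require Import ring lra.
Set Implicit Arguments. Unset Strict Implicit. Unset Printing Implicit Defensive.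
Import Order.TTheory GRing.Theory Num.Theory.
Import numFieldNormedType.Exports.
Local Open Scope classical_set_scope.
Local Open Scope ring_scope.

(** Twist the differential calculus of D by phi0 and let T(P, Q) be the
    concomitant
      <ga, [P al, Q be] + [Q al, P be]> + [al, be]_Q (P ga) + [al, be]_P (Q ga)
    of two bivectors.  It is the value of [P, Q]^phi0 on (al, be, ga): the
    difference is tensorial in Q, and bump functions reduce a tensorial statement
    to the wedge product of two global sections, where the Leibniz rule applies.

    Put P_k = N^k P.  Compatibility of P and N says that
      N* [al, be]_P = i_(P al) d(N* be) - i_(P be) d(N* al) + d(NP(al, be)).
    If the same identity holds for P_k, its defect S at P_(k+1) satisfies
    S = - S because N is torsion-free; so it holds for all k.  Hence
      [al, be]_(P_(k+1)) = [N* al, be]_(P_k) + [al, N* be]_(P_k) - N* [al, be]_(P_k),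
    and T_ij = T(P_i, P_j) satisfies
      T_(i+1,j) + T_(i,j+1) = T_ij(N* al, be, ga) + T_ij(al, N* be, ga),
      T_(i+1,j+1) = (T_(i+1,j) + T_(i,j+1))(al, be, N* ga) - T_ij(al, be, N*^2 ga).
    These relations and the symmetry of T_ij propagate T_00 = 0 by induction on
    i + j. *)

(** * Smooth functions on open subsets of R^n *)

Section Flat.
Context {R : realType}.

(* A family closed under differentiation, so that all its members are smooth. *)
Definition flat (m : nat) (t : R) : R :=
  if 0 < t then t^-1 ^+ m * expR (- t^-1) else 0.

(** Put u = 1/t in e^u >= u^(m+2) / (m+2)!. The quadratic rate makes the difference quotients at 0
    tend to 0. *)
Lemma flat_bound m (t : R) : `|flat m t| <= m.+2`!%:R * t ^+ 2.
Proof.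
rewrite /flat; case: ifPn => [t0|_]; last first.
  by rewrite normr0 mulr_ge0 ?ler0n ?sqr_ge0.
have u0 : 0 < t^-1 by rewrite invr_gt0.
rewrite ger0_norm; last by rewrite mulr_ge0 ?expR_ge0// exprn_ge0// ltW.
have := expR_ge1Dxn m.+1 (ltW u0); set E := expR _ => hE.
have E0 : 0 < E by exact: expR_gt0.
rewrite expRN -/E ler_pdivrMr//.
have h : t^-1 ^+ m.+2 <= m.+2`!%:R * E.
  rewrite mulrC -ler_pdivrMr ?ltr0n ?fact_gt0//.
  by apply: le_trans hE; rewrite lerDr ler01.
have -> : t^-1 ^+ m = t^-1 ^+ m.+2 * t ^+ 2.
  by rewrite !exprS expr0; field; rewrite gt_eqF.
by rewrite [leRHS]mulrAC ler_wpM2r// sqr_ge0.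
Qed.

(** For t > 0 this is the product rule for t^(-m) e^(-1/t); at 0 the derivative is 0 by
    [flat_bound]. *)
Lemma is_derive_flat m (t : R) :
  is_derive t 1 (flat m) (flat m.+2 t - m%:R * flat m.+1 t).
Proof.
have [t0|t0|->] := ltgtP t 0.
- rewrite /flat ltNge ltW//= mulr0 subr0.
  apply: (@near_eq_is_derive _ _ _ (cst 0)).
  near=> s; rewrite /= ltNge ltW//=.
  by near: s; exact: lt_nbhsl.
- have tn0 : t != 0 by rewrite gt_eqF.
  apply: (@near_eq_is_derive R R R (fun t : R => t^-1 ^+ m * expR (- t^-1))).
    near=> s; rewrite /flat ifT//.
    by near: s; exact: lt_nbhsr.
  rewrite /flat t0.
  have dV : is_derive t 1 (fun s : R => s^-1) (- t ^- 2).
    by have := @is_deriveV _ id t 1 1 tn0 (is_derive_id _ _);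
      rewrite /GRing.scale/= mulr1.
  have dX : is_derive t 1 (fun s : R => s^-1 ^+ m) (m%:R * t^-1 ^+ m.-1 * (- t ^- 2)).
    have := @is_deriveX _ _ _ m t 1 _ dV.
    by rewrite exprfctE /GRing.scale/=.
  have dN : is_derive t 1 (fun s : R => - s^-1) (t ^- 2).
    by rewrite -[t ^- 2]opprK; exact: is_deriveN.
  have dE : is_derive t 1 (fun s : R => expR (- s^-1)) (expR (- t^-1) * t ^- 2).
    exact: (@is_derive1_comp _ expR (fun s => - s^-1)).
  have := @is_deriveM _ _ _ _ t 1 _ _ dX dE; rewrite mulrfctE => dM.
  apply: (@is_derive_eq _ _ _ _ _ _ _ _ dM); rewrite /GRing.scale/= !exprVn.
  by case: m {dX dM} => [|m]; rewrite !exprS ?expr0; field; rewrite ?expf_neq0 ?gt_eqF.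
- rewrite /flat ltxx mulr0 subr0.
  have cv : h^-1 *: ((flat m \o shift 0) (h *: 1) - flat m 0) @[h --> 0^'] --> 0.
    apply/cvgr0Pnorm_lt => e e0.
    have C0 : 0 < m.+2`!%:R :> R by rewrite ltr0n fact_gt0.
    near=> h.
    have h0 : h != 0 by near: h; exact: nbhs_dnbhs_neq.
    rewrite /= /GRing.scale/= mulr1 addr0 {2}/flat ltxx subr0 normrM normrV ?unitfE//.
    have hn : 0 < `|h| by rewrite normr_gt0.
    apply: (@le_lt_trans _ _ (m.+2`!%:R * `|h|)).
      rewrite mulrC ler_pdivrMr// -mulrA -expr2 real_normK ?num_real//.
      exact: flat_bound.
    rewrite mulrC -ltr_pdivlMr//.
    near: h; apply: dnbhs0_lt; exact: divr_gt0.
  split; first by apply/cvg_ex; exists 0.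
  exact: cvg_lim.
Unshelve. all: by end_near.
Qed.

End Flat.

(** Differentiability depends only on the germ: the first-order expansion of f at y, with its
    little-o remainder, is also one of g. *)
Lemma differentiable_near_eq (R : realType) (V W : normedModType R)
    (f g : V -> W) (y : V) :
  (\near y, f y = g y) -> differentiable f y -> differentiable g y.
Proof.
move=> fg /diff_locallyP[cd Ed]; have fgy : f y = g y := nbhs_singleton fg.
have Eg : g \o shift y = cst (g y) + 'd f y +o_ 0 id.
  apply/eqaddoP => e e0; move/eqaddoP: Ed => /(_ _ e0) Ed.
  have fg0 : \forall h \near (0 : V), f (h + y) = g (h + y).
    by move/nbhs0P: fg; apply: filterS => h; rewrite addrC.
  near=> h; have -> : (g \o shift y - (cst (g y) + 'd f y)) h =
      (f \o shift y - (cst (f y) + 'd f y)) h.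
    rewrite /= -fgy; congr (_ - _) => /=; apply/esym.
    by near: h.
  by near: h.
have dg := diff_unique cd Eg.
by apply/diff_locallyP; rewrite dg.
Unshelve. all: by end_near.
Qed.

(** * Closure properties of C^k functions *)

Section Ck.
Context {R : realType} {n : nat}.
Implicit Types (V : set 'rV[R]_n) (f g : 'rV[R]_n -> R).

(** [Ck] imposes conditions at the points of V only, so they may be checked around each point
    separately; monotonicity in V is a special case. *)
Lemma Ck_local k V f :
  (forall y, V y -> exists2 U, U y & Ck k U f) -> Ck k V f.
Proof.
elim: k V f => [|k IH] V f H.
  by move=> y /H[U Uy CU]; exact: CU Uy.
split; first by move=> y /H[U Uy [dU _]]; exact: dU _ Uy.
by move=> i; apply: IH => y /H[U Uy [_ dU]]; exists U => //; exact: dU.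
Qed.

Lemma Ck_pred k V f : Ck k.+1 V f -> Ck k V f.
Proof.
elim: k f => [|k IH] f.
  by move=> [df _] y /df; exact: differentiable_continuous.
by move=> [df dd]; split => // i; apply: IH; exact: dd.
Qed.

Lemma Ck_eq k V f g :
  open V -> (forall y, V y -> f y = g y) -> Ck k V f -> Ck k V g.
Proof.
move=> oV; elim: k f g => [|k IH] f g fg.
  move=> cf y Vy; have := cf _ Vy; rewrite /prop_for /continuous_at (fg _ Vy).
  apply: cvg_trans; apply: (@near_eq_cvg _ _ (nbhs y)).
  by apply: filterS (open_nbhs_nbhs (conj oV Vy)) => z /fg.
have nfg y : V y -> \near y, f y = g y.
  by move=> Vy; apply: filterS (open_nbhs_nbhs (conj oV Vy)) => z /fg.
move=> [df dd]; split=> [y Vy|i].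
  by apply: differentiable_near_eq (df _ Vy); exact: nfg.
by apply: IH (dd i) => y Vy; apply: near_eq_derive; exact: nfg.
Qed.

Lemma Ck_cst k V (c : R) : Ck k V (fun=> c).
Proof.
elim: k c => [|k IH] c; first by move=> y _; exact: cst_continuous.
split; first by move=> y _; exact: differentiable_cst.
move=> i; have -> : (fun y => 'D_(delta_mx 0 i) (fun=> c) y) =
    (fun=> 0 : R) :> ('rV[R]_n -> R).
  by apply/funext => y; exact: derive_cst.
exact: IH.
Qed.

Lemma Ck_add k V f g : open V -> Ck k V f -> Ck k V g ->
  Ck k V (fun y => f y + g y).
Proof.
move=> oV; elim: k f g => [|k IH] f g.
  by move=> cf cg y Vy; exact: cvgD (cf _ Vy) (cg _ Vy).
move=> [df ddf] [dg ddg]; split.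
  by move=> y Vy; exact: differentiableD (df _ Vy) (dg _ Vy).
move=> i; apply: Ck_eq (IH _ _ (ddf i) (ddg i)) => // y Vy.
by apply/esym/deriveD; apply: diff_derivable; [exact: df|exact: dg].
Qed.

Lemma Ck_mul k V f g : open V -> Ck k V f -> Ck k V g ->
  Ck k V (fun y => f y * g y).
Proof.
move=> oV; elim: k f g => [|k IH] f g.
  by move=> cf cg y Vy; exact: cvgM (cf _ Vy) (cg _ Vy).
move=> Cf Cg; have [df ddf] := Cf; have [dg ddg] := Cg; split.
  by move=> y Vy; exact: differentiableM (df _ Vy) (dg _ Vy).
move=> i; apply: Ck_eq (Ck_add oV (IH _ _ (Ck_pred Cf) (ddg i))
  (IH _ _ (Ck_pred Cg) (ddf i))) => // y Vy.
by apply/esym/deriveM; apply: diff_derivable; [exact: df|exact: dg].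
Qed.

Lemma Ck_inv k V f : open V -> (forall y, V y -> f y != 0) -> Ck k V f ->
  Ck k V (fun y => (f y)^-1).
Proof.
move=> oV f0; elim: k => [|k IH].
  by move=> cf y Vy; apply: cvgV (cf _ Vy); exact: f0.
move=> Cf; have [df ddf] := Cf; split.
  by move=> y Vy; apply: differentiableV (df _ Vy) _; exact: f0.
(* The derivative - f^(-2) f' contains the inverse again, which is C^k by induction. *)
have CV := IH (Ck_pred Cf).
move=> i; apply: Ck_eq (Ck_mul oV (Ck_cst k V (-1))
  (Ck_mul oV (Ck_mul oV CV CV) (ddf i))) => // y Vy.
rewrite deriveV ?f0//; last by apply: diff_derivable; exact: df.
by rewrite /GRing.scale/= -invfM -expr2 mulN1r mulNr.
Qed.

(** Differentiation turns [flat m] into [flat m.+1] and [flat m.+2], hence an induction on k for all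
    m at once. *)
Lemma Ck_flat_comp k m V f : open V -> Ck k V f ->
  Ck k V (fun y => flat m (f y)).
Proof.
move=> oV; have dflat j (t : R) : differentiable (@flat R j) t.
  by apply/derivable1_diffP; have [] := is_derive_flat j t.
elim: k m => [|k IH] m.
  move=> cf y Vy; apply: continuous_comp; first exact: cf.
  exact: differentiable_continuous.
move=> Cf; have [df ddf] := Cf; split.
  by move=> y Vy; exact: differentiable_comp (df _ Vy) (dflat _ _).
move=> i; have CI := IH _ (Ck_pred Cf).
apply: Ck_eq (Ck_mul oV (Ck_add oV (CI m.+2)
  (Ck_mul oV (Ck_cst k V (- m%:R)) (CI m.+1))) (ddf i)) => // y Vy.
have dfy := df _ Vy.
rewrite [RHS]deriveE; last exact: differentiable_comp.
rewrite diff_comp//= -(deriveE _ dfy).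
have E := congr1 (@^~ ('D_(delta_mx 0 i) f y)) (diff1E (dflat m (f y))).
apply/esym; apply: etrans E _.
rewrite derive1E /GRing.scale/=.
by have [_ ->] := is_derive_flat m (f y); rewrite mulrC mulNr addrC.
Qed.

End Ck.

(** * Smooth functions on a manifold *)

Section SmoothOn.
Context {R : realType} {n : nat} {M : manifold R n}.
Implicit Types (U V W : set M) (f g : M -> R).

(** Inside the open image of the chart, this set is the preimage of U under the continuous inverse
    chart. *)
Lemma open_chart_image (c : chart R n M) U :
  is_chart c -> open U -> open (cmap c @` (cdom c `&` U)).
Proof.
move=> [oD oI K _ cV] oU; rewrite openE => _ [x [Dx Ux] <-].
have Ix : (cmap c @` cdom c) (cmap c x) by exists x.
have nU : nbhs (cmap c x) (cinv c @^-1` U).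
  by apply: (cV _ Ix); rewrite K//; exact: open_nbhs_nbhs.
apply: filterS (filterI (open_nbhs_nbhs (conj oI Ix)) nU) => _ [[z Dz <-]].
by rewrite /preimage/= K// => Uz; exists z.
Qed.

Lemma smooth_on_local U f :
  (forall x, U x -> exists2 W, W x & smooth_on W f) -> smooth_on U f.
Proof.
move=> H c ac k; apply: Ck_local => _ [x [Dx Ux] <-].
by have [W Wx sW] := H _ Ux; exists (cmap c @` (cdom c `&` W)); [exists x|exact: sW].
Qed.

Lemma smooth_on_sub U V f : V `<=` U -> smooth_on U f -> smooth_on V f.
Proof. by move=> VU sU; apply: smooth_on_local => x /VU Ux; exists U. Qed.

Lemma smooth_on_eq U f g : open U -> (forall x, U x -> f x = g x) ->
  smooth_on U f -> smooth_on U g.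
Proof.
move=> oU fg sf c ac k; have cc := atlas_chart ac.
apply: Ck_eq (sf c ac k); first exact: open_chart_image.
by move=> _ [x [Dx Ux] <-]; rewrite cmapK//; exact: fg.
Qed.

Lemma smooth_on_cst U (a : R) : smooth_on U (fun=> a).
Proof. by move=> c _ k; exact: Ck_cst. Qed.

Lemma smooth_on_add U f g : open U -> smooth_on U f -> smooth_on U g ->
  smooth_on U (fun x => f x + g x).
Proof.
move=> oU sf sg c ac k; apply: Ck_add (sf c ac k) (sg c ac k).
exact: open_chart_image (atlas_chart ac) oU.
Qed.

Lemma smooth_on_mul U f g : open U -> smooth_on U f -> smooth_on U g ->
  smooth_on U (fun x => f x * g x).
Proof.
move=> oU sf sg c ac k; apply: Ck_mul (sf c ac k) (sg c ac k).
exact: open_chart_image (atlas_chart ac) oU.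
Qed.

Lemma smooth_on_inv U f : open U -> (forall x, U x -> f x != 0) ->
  smooth_on U f -> smooth_on U (fun x => (f x)^-1).
Proof.
move=> oU f0 sf c ac k; have cc := atlas_chart ac.
apply: Ck_inv (sf c ac k); first exact: open_chart_image.
by move=> _ [x [Dx Ux] <-]; rewrite cmapK//; exact: f0.
Qed.

Lemma smooth_on_flat U m f : open U -> smooth_on U f ->
  smooth_on U (fun x => flat m (f x)).
Proof.
move=> oU sf c ac k; apply: Ck_flat_comp (sf c ac k).
exact: open_chart_image (atlas_chart ac) oU.
Qed.

Lemma smooth_on_sum U (I : Type) (s : seq I) (F : I -> M -> R) : open U ->
  (forall i, smooth_on U (F i)) -> smooth_on U (fun x => \sum_(i <- s) F i x).
Proof.
move=> oU sF; elim: s => [|i s IH].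
  by under eq_fun do rewrite big_nil; exact: smooth_on_cst.
under eq_fun do rewrite big_cons.
  exact: (smooth_on_add oU (sF i) IH).
Qed.

Lemma smooth_cst (a : R) : smooth (fun _ : M => a).
Proof. exact: smooth_on_cst. Qed.

Lemma smooth_add f g : smooth f -> smooth g -> smooth (fun x => f x + g x).
Proof. exact: (smooth_on_add openT). Qed.

Lemma smooth_mul f g : smooth f -> smooth g -> smooth (fun x => f x * g x).
Proof. exact: (smooth_on_mul openT). Qed.

Lemma smooth_opp f : smooth f -> smooth (fun x => - f x).
Proof.
move=> sf; under eq_fun do rewrite -mulN1r.
exact: smooth_mul (smooth_cst _) sf.
Qed.

Lemma smooth_chart (c : chart R n M) (i : 'I_n) : atlas c ->
  smooth_on (cdom c) (fun x => cmap c x 0 i).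
Proof. by move=> ac c' ac' k; exact: (atlas_compat ac' ac i k). Qed.

(** No normalisation at x0: chi serves as a factor that is divided out again where it does not
    vanish. Vanishing off a closed K inside U lets chi f be extended by zero. *)
Definition bump U (x0 : M) (chi : M -> R) : Prop :=
  [/\ smooth chi, chi x0 != 0 &
      exists2 K, closed K & K `<=` U /\ forall x, ~ K x -> chi x = 0].

(** Near points of K both factors are smooth; off K the product is 0. *)
Lemma smooth_on_bump U W x0 chi f : bump U x0 chi -> open U -> open W ->
  smooth_on (W `&` U) f -> smooth_on W (fun x => chi x * f x).
Proof.
move=> [sc _ [K cK [KU cK0]]] oU oW sf; apply: smooth_on_local => x Wx.
have [Kx|nKx] := pselect (K x).
  exists (W `&` U); first by split => //; exact: KU.
  apply: (smooth_on_mul (openI oW oU) _ sf).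
  exact: smooth_on_sub sc.
exists (~` K) => //; apply: smooth_on_eq (smooth_on_cst _ 0).
  exact: closed_openC.
by move=> y /cK0 ->; rewrite mul0r.
Qed.

Lemma smooth_bump U f x0 chi : bump U x0 chi -> open U -> smooth_on U f ->
  smooth (fun x => chi x * f x).
Proof. by move=> bc oU sf; apply: smooth_on_bump bc _ openT _; rewrite ?setTI. Qed.

(** In a chart, take [flat 0] of s^2 - |y - y0|^2 and extend it by zero. It vanishes off the
    preimage of a compact box, which is closed because M is Hausdorff. *)
Lemma ex_bump U x0 : open U -> U x0 -> exists chi, bump U x0 chi.
Proof.
move=> oU Ux0; have [c ac Dx0] := atlas_cover x0; have cc := atlas_chart ac.
set y0 := cmap c x0.
have : nbhs y0 (cmap c @` (cdom c `&` U)).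
  by apply: open_nbhs_nbhs; split; [exact: open_chart_image|exists x0].
rewrite -nbhs_ballE => -[e /= e0 eW].
(* Half the radius keeps the closed box inside the open ball, a ball of the sup norm. *)
pose s := e / 2; have s0 : 0 < s by rewrite divr_gt0.
pose box : set 'rV[R]_n := [set v | forall i, `[y0 0 i - s, y0 0 i + s]%classic (v 0 i)].
have cbox : compact box.
  apply: (@rV_compact _ _ (fun i => `[y0 0 i - s, y0 0 i + s]%classic)) => i.
  exact: segment_compact.
have boxW : box `<=` cmap c @` (cdom c `&` U).
  move=> v bv; apply: eW; split=> // i j; rewrite (ord1 i) /ball/=.
  have := bv j; rewrite /= in_itv/= => /andP[h1 h2].
  rewrite ltr_distl /s in h1 h2 *; apply/andP; split; lra.
pose q x := s ^+ 2 - \sum_i (cmap c x 0 i - y0 0 i) ^+ 2.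
pose chi x := if x \in cdom c then flat 0 (q x) else 0.
pose K := cinv c @` box.
have cK : closed K.
  apply: compact_closed; first exact: mspace_hausdorff.
  apply: continuous_compact cbox; apply: continuous_in_subspaceT => v.
  rewrite inE => /boxW[x [Dx _] <-]; apply: (cinv_cont cc); by exists x.
have KU : K `<=` U.
  by move=> _ [v /boxW[x [Dx Ux] <-] <-]; rewrite cmapK.
have chiK x : ~ K x -> chi x = 0.
  rewrite /chi; case: ifPn => // /set_mem Dx nK; rewrite /flat ifF//.
  (* Where q > 0, every coordinate is within s of that of y0, so the point lies in K. *)
  apply: contra_notF nK; rewrite subr_gt0 => qx; exists (cmap c x); last exact: cmapK.
  move=> i; rewrite /= in_itv/= -ler_distl.
  rewrite -(ler_pXn2r (n := 2))// ?nnegrE// ?(ltW s0)// real_normK ?num_real//.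
  apply: le_trans (ltW qx); rewrite (bigD1 i)//= lerDl sumr_ge0// => j _.
  exact: sqr_ge0.
have sq : smooth_on (cdom c) q.
  have oD := cdom_open cc.
  have sd i : smooth_on (cdom c) (fun x => cmap c x 0 i - y0 0 i).
    exact: (smooth_on_add oD (smooth_chart _ ac) (smooth_on_cst _ _)).
  have sS : smooth_on (cdom c) (fun x => \sum_i (cmap c x 0 i - y0 0 i) ^+ 2).
    by apply: (smooth_on_sum _ oD) => i; exact: (smooth_on_mul oD (sd i) (sd i)).
  apply: smooth_on_eq (smooth_on_add oD (smooth_on_cst _ (s ^+ 2))
    (smooth_on_mul oD (smooth_on_cst _ (-1)) sS)) => // x _.
  by rewrite /q mulN1r.
exists chi; split; last by exists K.
- apply: smooth_on_local => x _; have [Kx|nKx] := pselect (K x); last first.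
    exists (~` K) => //; apply: smooth_on_eq (smooth_on_cst _ 0).
      exact: closed_openC.
    by move=> y /chiK ->.
  exists (cdom c); first by case: Kx => v /boxW[z [Dz _] <-] <-; rewrite cmapK.
  apply: smooth_on_eq (smooth_on_flat 0 (cdom_open cc) sq).
    exact: cdom_open.
  by move=> y Dy; rewrite /chi mem_set.
- rewrite /chi mem_set// /flat /q big1 ?subr0; last first.
    by move=> i _; rewrite subrr expr0n.
  rewrite exprn_gt0//= expr0 mul1r; exact: lt0r_neq0 (expR_gt0 _).
Qed.

Lemma smooth_continuous f : smooth f -> continuous f.
Proof.
move=> sf x; have [c ac Dx] := atlas_cover x; have cc := atlas_chart ac.
have Ix : (cmap c @` (cdom c `&` setT)) (cmap c x) by exists x.
have cfc : {for cmap c x, continuous (fun y => f (cinv c y))} := sf c ac 0 _ Ix.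
have cg : {for x, continuous (fun z => f (cinv c (cmap c z)))}.
  exact: (continuous_comp (cmap_cont cc Dx) cfc).
move: cg; rewrite /prop_for /continuous_at cmapK//.
apply: cvg_trans; apply: (@near_eq_cvg _ _ (nbhs x)).
by apply: filterS (open_nbhs_nbhs (conj (cdom_open cc) Dx)) => z Dz; rewrite cmapK.
Qed.

(** A converse to [smooth_bump]: on the open set where chi does not vanish, f = chi^(-1) (chi f). *)
Lemma smooth_on_bumps U f : open U ->
  (forall chi x0, bump U x0 chi -> smooth (fun x => chi x * f x)) ->
  smooth_on U f.
Proof.
move=> oU H; apply: smooth_on_local => x Ux.
have [chi bc] := ex_bump oU Ux; have [sc cx _] := bc.
pose W := [set y | chi y != 0].
have oW : open W.
  have -> : W = chi @^-1` [set t | t != 0] by [].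
  by apply: open_comp; [move=> y _; exact: smooth_continuous|exact: open_neq].
exists W => //; have sW g : smooth g -> smooth_on W g by exact: smooth_on_sub.
apply: (@smooth_on_eq W (fun y => (chi y)^-1 * (chi y * f y))) => //.
  by move=> y Wy; rewrite mulKf.
apply: (smooth_on_mul oW _ (sW _ (H _ _ bc))).
exact: (smooth_on_inv oW _ (sW _ sc)).
Qed.

End SmoothOn.

(** * Multilinear algebra *)

Section Covectors.
Context {R : realType} {V : vectType R}.
Implicit Types (a b : 'Hom(V, R^o)) (u v : V).

Lemma covecDl (c : R) a b u : (c *: a + b) u = c * a u + b u.
Proof. by rewrite add_lfunE scale_lfunE. Qed.

Lemma covecDr a (c : R) u v : a (c *: u + v) = c * a u + a v.
Proof. by rewrite linearP. Qed.

Lemma covecD a u v : a (u + v) = a u + a v. Proof. exact: linearD. Qed.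
Lemma covecB a u v : a (u - v) = a u - a v. Proof. exact: linearB. Qed.
Lemma covecN a u : a (- u) = - a u. Proof. exact: linearN. Qed.
Lemma covecZ a (c : R) u : a (c *: u) = c * a u. Proof. exact: linearZ. Qed.

Lemma covec_inj u v : (forall a, a u = a v) -> u = v.
Proof.
move=> h; rewrite (coord_vbasis (memvf u)) (coord_vbasis (memvf v)).
apply: eq_bigr => i _; congr (_ *: _).
by have := h (dual_vbasis i); rewrite !lfunE.
Qed.

Lemma covec_basis r (e : r.-tuple V) a : basis_of fullv e ->
  a = \sum_i a (tnth e i) *: linfun (coord e i : V -> R^o).
Proof.
move=> he; apply/lfunP => v; rewrite sum_lfunE.
rewrite {1}(coord_basis he (memvf v)) linear_sum /=; apply: eq_bigr => i _.
by rewrite linearZ /= scale_lfunE lfunE /= (tnth_nth 0) /GRing.scale /= mulrC.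
Qed.

End Covectors.

(** Iterating this removal of the first bit expands a wedge product on an explicit list of
    covectors. *)
Lemma sum_tuple_bool (V : nmodType) n (F : seq bool -> V) :
  \sum_(m : n.+1.-tuple bool) F m =
  \sum_(m : n.-tuple bool) (F (true :: m) + F (false :: m)).
Proof.
pose h (p : bool * n.-tuple bool) := cons_tuple p.1 p.2.
rewrite (reindex h) /=; last first.
  exists (fun m => (thead m, behead_tuple m)) => [[b m] _|m _].
    by congr pair; exact: val_inj.
  by rewrite [in RHS](tuple_eta m); exact: val_inj.
rewrite -(pair_bigA _ (fun b m => F (b :: val m)))/= exchange_big/=.
by apply: eq_bigr => m _; rewrite big_bool.
Qed.

Lemma sum_tuple0 (V : nmodType) (F : seq bool -> V) :
  \sum_(m : 0.-tuple bool) F m = F [::].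
Proof. by rewrite (big_pred1 [tuple])// => m; apply/esym/eqP; exact: tuple0. Qed.

(** * Wedge products in low degree, and algebra of bivectors *)

Section Wedge.
Context {R : realType} {V : vectType R}.
Implicit Types (P Q : mvec V) (a b c : 'Hom(V, R^o)).

Lemma wedge_size p q P Q s : pvector p P -> pvector q Q ->
  size s != (p + q)%N -> wedge P Q s = 0.
Proof.
move=> hP hQ hs; apply: big1 => m _.
have sm : size (mask m s) = count id m by rewrite size_mask// size_tuple.
have sm' : size (mask (map negb m) s) = count negb m.
  by rewrite size_mask ?size_map ?size_tuple// count_map.
have e : (count id m + count negb m)%N = size s.
  by rewrite -[RHS](size_tuple m); exact: (count_predC id m).
have [cp|cp] := eqVneq (count id m) p; last first.
  by rewrite (pvector_size hP) ?sm// mulr0 mul0r.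
rewrite (pvector_size hQ) ?mulr0// sm'; apply: contra hs => /eqP <-.
by apply/eqP; rewrite -cp; exact: esym e.
Qed.

(** In this formula and the next two no degrees are assumed, so that each serves all bidegrees; the
    terms of wrong degree are later removed by [pvector_size]. *)
Lemma wedge1 P Q a : wedge P Q [:: a] = P [:: a] * Q [::] + P [::] * Q [:: a].
Proof.
pose F m := (-1) ^+ ninv m * P (mask m [:: a]) * Q (mask (map negb m) [:: a]).
rewrite /wedge (sum_tuple_bool _ F).
rewrite (sum_tuple0 (fun m => F (true :: m) + F (false :: m))) /F /=; ring.
Qed.

Lemma wedge2 P Q a b : wedge P Q [:: a; b] =
  P [:: a; b] * Q [::] + P [:: a] * Q [:: b] - P [:: b] * Q [:: a]
  + P [::] * Q [:: a; b].
Proof.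
pose F m := (-1) ^+ ninv m * P (mask m [:: a; b]) * Q (mask (map negb m) [:: a; b]).
rewrite /wedge (sum_tuple_bool _ F).
pose F1 m := F (true :: m) + F (false :: m).
rewrite (sum_tuple_bool _ F1).
rewrite (sum_tuple0 (fun m => F1 (true :: m) + F1 (false :: m))) /F1 /F /=; ring.
Qed.

Lemma wedge3 P Q a b c : wedge P Q [:: a; b; c] =
  P [:: a; b; c] * Q [::] +
  (P [:: a; b] * Q [:: c] - P [:: a; c] * Q [:: b] + P [:: b; c] * Q [:: a]) +
  (P [:: a] * Q [:: b; c] - P [:: b] * Q [:: a; c] + P [:: c] * Q [:: a; b]) +
  P [::] * Q [:: a; b; c].
Proof.
pose F m := (-1) ^+ ninv m * P (mask m [:: a; b; c])
  * Q (mask (map negb m) [:: a; b; c]).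
pose F1 m := F (true :: m) + F (false :: m).
rewrite /wedge (sum_tuple_bool _ F) (sum_tuple_bool _ F1).
pose F2 m := F1 (true :: m) + F1 (false :: m).
rewrite (sum_tuple_bool _ F2).
rewrite (sum_tuple0 (fun m => F2 (true :: m) + F2 (false :: m))) /F2 /F1 /F /=; ring.
Qed.

Lemma pvector2 P : (forall s, size s != 2 -> P s = 0) ->
  (forall k a b c, P [:: k *: a + b; c] = k * P [:: a; c] + P [:: b; c]) ->
  (forall a b, P [:: a; b] = - P [:: b; a]) -> pvector 2 P.
Proof.
move=> P0 Pl Pa; split=> // [s t k a b|s].
  case: s t => [|c s] t.
    case: t => [|d [|e t]]; try by rewrite !P0// mulr0 addr0.
    exact: Pl.
  case: s t => [|d s] [|e t]; try by rewrite !P0 ?size_cat//= ?addnS// mulr0 addr0.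
  by rewrite /= Pa Pl Pa (Pa b) mulrN opprD !opprK.
case: s => [|a [|b [|c s]]] //; last by rewrite P0.
rewrite /= !inE andbT negbK => /eqP <-.
by have := Pa a a; move: (P _) => x; lra.
Qed.

Section Bivector.
Variable (P : mvec V).
Hypothesis hP : pvector 2 P.

Lemma bivDl k a b c : P [:: k *: a + b; c] = k * P [:: a; c] + P [:: b; c].
Proof. exact: (pvector_lin hP [::]). Qed.

Lemma bivDr k a b c : P [:: c; k *: a + b] = k * P [:: c; a] + P [:: c; b].
Proof. exact: (pvector_lin hP [:: c] [::]). Qed.

(** Polarisation of P(a + b, a + b) = 0. *)
Lemma biv_skew a b : P [:: a; b] = - P [:: b; a].
Proof.
have P0 c : P [:: c; c] = 0 by rewrite (pvector_alt hP)//= inE eqxx.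
have := P0 (1 *: a + b); rewrite bivDl !bivDr !P0.
move: (P [:: a; b]) (P [:: b; a]) => x y; lra.
Qed.

Lemma biv0l c : P [:: 0; c] = 0.
Proof. by have := bivDl 1 0 0 c; rewrite scaler0 addr0; move: (P _) => x; lra. Qed.

Lemma bivZl k a c : P [:: k *: a; c] = k * P [:: a; c].
Proof. by rewrite -(addr0 (k *: a)) bivDl biv0l addr0. Qed.

Lemma bivZr k a c : P [:: c; k *: a] = k * P [:: c; a].
Proof. by rewrite (biv_skew c (k *: a)) bivZl -mulrN -(biv_skew c a). Qed.

Lemma biv_suml (I : Type) (s : seq I) (f : I -> R) (e : I -> 'Hom(V, R^o)) c :
  P [:: \sum_(i <- s) f i *: e i; c] = \sum_(i <- s) f i * P [:: e i; c].
Proof.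
elim: s => [|i s IH]; first by rewrite !big_nil biv0l.
by rewrite !big_cons bivDl IH.
Qed.

Lemma biv_sumr (I : Type) (s : seq I) (f : I -> R) (e : I -> 'Hom(V, R^o)) c :
  P [:: c; \sum_(i <- s) f i *: e i] = \sum_(i <- s) f i * P [:: c; e i].
Proof.
rewrite biv_skew biv_suml -sumrN; apply: eq_bigr => i _.
by rewrite -mulrN -biv_skew.
Qed.

Lemma sharp_skew a b : b (sharp P a) = - a (sharp P b).
Proof. by rewrite !(sharpE hP) biv_skew. Qed.

End Bivector.

End Wedge.

(** * Smooth sections and bivector fields *)

Section Sections.
Context {R : realType} {n r : nat} {M : manifold R n} {A : vbundle M r}.
Implicit Types (X Y : section A) (al be : cosection A) (f : M -> R)
  (P Q : mvfield A).

Lemma smooth_section_scale f X : smooth f -> smooth_section X ->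
  smooth_section (fun x => f x *: X x : A x).
Proof.
move=> sf sX F fF i; under eq_fun do rewrite linearZ/=.
apply: smooth_on_mul (sX F fF i); first exact: frames_open.
exact: smooth_on_sub sf.
Qed.

Lemma smooth_section_add X Y : smooth_section X -> smooth_section Y ->
  smooth_section (fun x => X x + Y x : A x).
Proof.
move=> sX sY F fF i; under eq_fun do rewrite linearD/=.
by apply: smooth_on_add (sX F fF i) (sY F fF i); exact: frames_open.
Qed.

Lemma smooth_coapp_endo (N : endo A) al : smooth_endo N ->
  smooth_cosection al -> smooth_cosection (coapp_endo N al).
Proof.
move=> sN sal X sX; under eq_fun do rewrite comp_lfunE.
exact: sal (sN _ sX).
Qed.

Section Frame.
Variables (F : lframe r A) (x0 : M) (chi : M -> R).
Hypotheses (fF : frames F) (bchi : bump (fdom F) x0 chi).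

(** A local frame vector made global: outside the domain of the frame [fvec] is arbitrary, but chi
    vanishes there. *)
Definition bump_section (i : 'I_r) : section A :=
  fun x => chi x *: tnth (fvec F x) i.

Definition bump_cosection (i : 'I_r) : cosection A :=
  fun x => chi x *: linfun (coord (fvec F x) i : A x -> R^o).

Lemma smooth_bump_section i : smooth_section (bump_section i).
Proof.
move=> G fG j; under eq_fun do rewrite linearZ/=.
have := frames_compat fF fG i j; rewrite setIC => sGF.
exact: (smooth_on_bump bchi (frames_open fF) (frames_open fG) sGF).
Qed.

Lemma smooth_bump_cosection i : smooth_cosection (bump_cosection i).
Proof.
move=> X sX; under eq_fun do rewrite scale_lfunE lfunE/=.
exact: (smooth_bump bchi (frames_open fF) (sX F fF i)).
Qed.

End Frame.

(** Testing X against [bump_cosection] gives chi times a coordinate of X, and [smooth_on_bumps]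
    removes chi. *)
Lemma smooth_section_test X :
  (forall al, smooth_cosection al -> smooth (fun x => al x (X x))) ->
  smooth_section X.
Proof.
move=> H F fF i; apply: smooth_on_bumps => [|chi x0 bc]; first exact: frames_open.
have := H _ (smooth_bump_cosection fF bc i).
by congr smooth; apply/funext => x; rewrite scale_lfunE lfunE.
Qed.

Lemma ex_smooth_cosection x0 (a : 'Hom(A x0, R^o)) :
  exists2 al : cosection A, smooth_cosection al & al x0 = a.
Proof.
have [F fF Fx0] := frames_cover A x0.
have [chi bc] := ex_bump (frames_open fF) Fx0; have [_ c0 _] := bc.
(* The inverse compensates the value of the bump function at x0. *)
pose k i := (chi x0)^-1 * a (tnth (fvec F x0) i).
exists (fun x => \sum_i k i *: bump_cosection F chi i x); last first.
  rewrite [RHS](covec_basis a (frames_basis fF Fx0)); apply: eq_bigr => i _.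
  by rewrite scalerA mulrAC mulVf// mul1r.
elim: (index_enum _) => [|i s IH] X sX.
  under eq_fun do rewrite big_nil zero_lfunE; exact: smooth_cst.
under eq_fun do rewrite big_cons add_lfunE scale_lfunE.
exact: (smooth_add (smooth_mul (smooth_cst (k i))
  (smooth_bump_cosection fF bc i sX)) (IH _ sX)).
Qed.

Lemma pvfield2P P : (forall x, pvector 2 (P x)) ->
  (forall al be, smooth_cosection al -> smooth_cosection be ->
     smooth (fun x => P x [:: al x; be x])) -> pvfield 2 P.
Proof.
move=> hP sP; split=> // al sal.
have := sP _ _ (sal ord0) (sal ord_max).
by congr smooth; apply/funext => x; rewrite enum_ordSl enum_ordSl enum_ord0/=;
  congr (P x [:: _; al _ x]); exact: val_inj.
Qed.

Lemma pvfield_smooth P al be : pvfield 2 P -> smooth_cosection al ->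
  smooth_cosection be -> smooth (fun x => P x [:: al x; be x]).
Proof.
move=> [_ sP] sal sbe.
have := sP (fun i => if val i == 0%N then al else be).
have h (i : 'I_2) : smooth_cosection (if val i == 0%N then al else be).
  by case: ifP.
move=> /(_ h); congr smooth; apply/funext => x.
by rewrite enum_ordSl enum_ordSl enum_ord0.
Qed.

Lemma smooth_sharp P al : pvfield 2 P -> smooth_cosection al ->
  smooth_section (sharp_field P al).
Proof.
move=> hP sal; apply: smooth_section_test => be sbe.
have := pvfield_smooth hP sal sbe.
by congr smooth; apply/funext => x; rewrite (sharpE (hP.1 x)).
Qed.

Lemma pvfield_fun f : smooth f -> pvfield 0 (mv_of_fun A f).
Proof.
move=> sf; split=> [x|al _].
  split=> [[]//|s t c a b|[]//].
  by case: s => [|? ?] /=; rewrite mulr0 addr0.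
by have := sf; congr smooth; apply/funext => x; rewrite enum_ord0.
Qed.

Lemma pvector_section X x : pvector 1 (mv_of_section X x).
Proof.
split=> [[|a []]//|s t c a b|[|a [|b s]]//].
case: s => [|d s]; first case: t => [|e t]; rewrite /= ?mulr0 ?addr0//.
  by rewrite covecDl.
by case: s => [|? ?] /=; rewrite mulr0 addr0.
Qed.

Lemma pvfield_section X : smooth_section X -> pvfield 1 (mv_of_section X).
Proof.
move=> sX; split=> [x|al sal]; first exact: pvector_section.
have := sal ord0 _ sX.
by congr smooth; apply/funext => x; rewrite enum_ordSl enum_ord0.
Qed.

Lemma wedge_sections X Y x a b :
  wedge (mv_of_section X x) (mv_of_section Y x) [:: a; b] =
  a (X x) * b (Y x) - b (X x) * a (Y x).
Proof. by rewrite wedge2 /=; ring. Qed.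

Lemma pvfield_wedge X Y : smooth_section X -> smooth_section Y ->
  pvfield 2 (fun x => wedge (mv_of_section X x) (mv_of_section Y x)).
Proof.
move=> sX sY; apply: pvfield2P => [x|al be sal sbe].
  apply: pvector2 => [s hs|k a b c|a b].
  - by apply: wedge_size hs; exact: pvector_section.
  - by rewrite !wedge_sections !covecDl; ring.
  - by rewrite !wedge_sections; ring.
under eq_fun do rewrite wedge_sections.
exact: (smooth_add (smooth_mul (sal _ sX) (sbe _ sY))
  (smooth_opp (smooth_mul (sbe _ sX) (sal _ sY)))).
Qed.

Lemma pvfield_scale f P : smooth f -> pvfield 2 P ->
  pvfield 2 (fun x s => f x * P x s).
Proof.
move=> sf hP; apply: pvfield2P => [x|al be sal sbe].
  apply: pvector2 => [s hs|k a b c|a b].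
  - by rewrite (pvector_size (hP.1 x))// mulr0.
  - by rewrite (bivDl (hP.1 x)); ring.
  - by rewrite (biv_skew (hP.1 x)) mulrN.
exact: (smooth_mul sf (pvfield_smooth hP sal sbe)).
Qed.

Lemma pvfield_add P Q : pvfield 2 P -> pvfield 2 Q ->
  pvfield 2 (fun x s => P x s + Q x s).
Proof.
move=> hP hQ; apply: pvfield2P => [x|al be sal sbe].
  apply: pvector2 => [s hs|k a b c|a b].
  - by rewrite (pvector_size (hP.1 x))// (pvector_size (hQ.1 x))// addr0.
  - by rewrite (bivDl (hP.1 x)) (bivDl (hQ.1 x)); ring.
  - by rewrite (biv_skew (hP.1 x)) (biv_skew (hQ.1 x)) opprD.
exact: (smooth_add (pvfield_smooth hP sal sbe) (pvfield_smooth hQ sal sbe)).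
Qed.

Lemma pvfield_zero : pvfield 2 (fun (x : M) (_ : seq 'Hom(A x, R^o)) => 0 : R).
Proof.
apply: pvfield2P => [x|al be _ _]; last exact: smooth_cst.
by apply: pvector2 => // *; rewrite ?mulr0 ?addr0 ?oppr0.
Qed.

(* In a local frame e with coframe e', and with a bump function chi, one has
   2 chi^4 P = sum_ij P(chi e'_i, chi e'_j) (chi e_i) /\ (chi e_j), and this
   holds on all of M. *)
Lemma bump_bivector P F x0 chi : pvfield 2 P -> frames F ->
  bump (fdom F) x0 chi ->
  (fun x s => 2%:R * (chi x * chi x * (chi x * chi x)) * P x s) =
  (fun x s => \sum_(ij : 'I_r * 'I_r)
     P x [:: bump_cosection F chi ij.1 x; bump_cosection F chi ij.2 x] *
     wedge (mv_of_section (bump_section F chi ij.1) x)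
           (mv_of_section (bump_section F chi ij.2) x) s).
Proof.
move=> hP fF [_ _ [K _ [KF chiK]]]; 
apply: functional_extensionality_dep => x; apply/funext => s.
have hPx := hP.1 x; have pv i := pvector_section (bump_section F chi i) x.
have [s2|s2] := eqVneq (size s) 2; last first.
  rewrite (pvector_size hPx)// mulr0 big1// => ij _.
  by rewrite (wedge_size (pv _) (pv _))// mulr0.
case: s s2 => [//|a [//|b [|//]]] _.
pose c (i : 'I_r) : 'Hom(A x, R^o) := linfun (coord (fvec F x) i : A x -> R^o).
pose S (u v : 'Hom(A x, R^o)) : R := \sum_(ij : 'I_r * 'I_r) u (tnth (fvec F x) ij.1) *
  (v (tnth (fvec F x) ij.2) * P x [:: c ij.1; c ij.2]).
transitivity (chi x * chi x * (chi x * chi x) * (S a b - S b a)); last first.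
  rewrite /S -sumrB mulr_sumr; apply: eq_bigr => ij _.
  rewrite wedge_sections /bump_cosection /bump_section !covecZ.
  rewrite (bivZl hPx) (bivZr hPx).
 rewrite -!/(c _) /GRing.scale/=; ring.
(* Where chi vanishes both sides are 0. Elsewhere x lies in the domain of the frame, S is the
   expansion of P, and S a b - S b a = 2 P(a, b). *)
have [->|chi0] := eqVneq (chi x) 0; first by rewrite !(mulr0, mul0r).
have Fx : fdom F x by apply: KF; apply: contrapT => /chiK; exact/eqP.
have PS u v : P x [:: u; v] = S u v.
  rewrite {1}(covec_basis u (frames_basis fF Fx)) (biv_suml hPx).
  rewrite /S -(pair_bigA _ (fun i j => u (tnth (fvec F x) i) *
    (v (tnth (fvec F x) j) * P x [:: c i; c j])))/=.
  apply: eq_bigr => i _; rewrite -mulr_sumr; congr (_ * _).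
  by rewrite {1}(covec_basis v (frames_basis fF Fx)) (biv_sumr hPx).
by rewrite -!PS (biv_skew hPx b a); ring.
Qed.

(** Phi is a value at x0, linear over functions. The identity of [bump_bivector] is global, so Phi,
    which takes whole fields, applies to both sides of it; the factor 2 chi(x0)^4 is then
    cancelled. *)
Lemma bivector_eq0 (Phi : mvfield A -> R) (x0 : M) :
  (forall f P Q, smooth f -> pvfield 2 P -> pvfield 2 Q ->
     Phi (fun x s => f x * P x s + Q x s) = f x0 * Phi P + Phi Q) ->
  (forall X Y, smooth_section X -> smooth_section Y ->
     Phi (fun x => wedge (mv_of_section X x) (mv_of_section Y x)) = 0) ->
  forall P, pvfield 2 P -> Phi P = 0.
Proof.
move=> PhiD PhiW P hP; have [F fF Fx0] := frames_cover A x0.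
have [chi bc] := ex_bump (frames_open fF) Fx0; have [sc c0 _] := bc.
have Phi0 : Phi (fun x s => 0) = 0.
  have := PhiD (fun=> 1) _ _ (smooth_cst 1) pvfield_zero pvfield_zero.
  by rewrite /= mulr0 addr0 mul1r; move: (Phi _) => w; lra.
have PhiZ f Q : smooth f -> pvfield 2 Q ->
    Phi (fun x s => f x * Q x s) = f x0 * Phi Q.
  move=> sf hQ; have := PhiD _ _ _ sf hQ pvfield_zero; rewrite Phi0 addr0 => <-.
  congr Phi; apply: functional_extensionality_dep => x; apply/funext => s.
  by rewrite addr0.
have s4 : smooth (fun x => 2%:R * (chi x * chi x * (chi x * chi x))).
  have s2 := smooth_mul sc sc.
  exact: (smooth_mul (smooth_cst 2%:R) (smooth_mul s2 s2)).
have nz : 2%:R * (chi x0 * chi x0 * (chi x0 * chi x0)) != 0.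
  by rewrite !mulf_neq0// pnatr_eq0.
apply: (mulfI nz); rewrite mulr0 -(PhiZ _ _ s4 hP) (bump_bivector hP fF bc).
have sb i := smooth_bump_section fF bc i.
have sb' i := smooth_bump_cosection fF bc i.
pose T (ij : 'I_r * 'I_r) : mvfield A := fun x s =>
  P x [:: bump_cosection F chi ij.1 x; bump_cosection F chi ij.2 x] *
  wedge (mv_of_section (bump_section F chi ij.1) x)
        (mv_of_section (bump_section F chi ij.2) x) s.
have sP ij := pvfield_smooth hP (sb' ij.1) (sb' ij.2).
have hW ij := pvfield_wedge (sb ij.1) (sb ij.2).
have hT ij : pvfield 2 (T ij) by exact: (pvfield_scale (sP ij) (hW ij)).
have PT ij : Phi (T ij) = 0.
  by have := PhiZ _ _ (sP ij) (hW ij); rewrite PhiW// mulr0.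
(* The induction over partial sums also carries that they are bivector fields, as the linearity of
   Phi requires. *)
suff [] : pvfield 2 (fun x s => \sum_(ij <- index_enum ('I_r * 'I_r)%type) T ij x s)
  /\ Phi (fun x s => \sum_(ij <- index_enum ('I_r * 'I_r)%type) T ij x s) = 0 by [].
elim: (index_enum _) => [|ij l [hl Pl]].
  have -> : (fun x s => \sum_(ij <- [::]) T ij x s) =
      (fun (x : M) (_ : seq 'Hom(A x, R^o)) => 0 : R).
    by apply: functional_extensionality_dep => x; apply/funext => s; rewrite big_nil.
  by split=> //; exact: pvfield_zero.
have -> : (fun x s => \sum_(ij <- ij :: l) T ij x s) =
    (fun x s => 1 * T ij x s + \sum_(ij <- l) T ij x s).
  apply: functional_extensionality_dep => x; apply/funext => s.
  by rewrite big_cons mul1r.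
split; last first.
  by rewrite (PhiD _ _ _ (smooth_cst 1) (hT ij) hl) PT Pl mulr0 addr0.
exact: (pvfield_add (pvfield_scale (smooth_cst 1) (hT ij)) hl).
Qed.

End Sections.

(** * The Schouten bracket of bivector fields *)

Section Calculus.
Context {R : realType} {n r : nat} {M : manifold R n} {A : vbundle M r}
  (D : lie_algebroid A).
Implicit Types (X Y Z : section A) (al be ga : cosection A) (f g : M -> R)
  (P Q S : mvfield A).
Let ax := la_axioms D.

Lemma anchorD x (v : A x) f g : smooth f -> smooth g ->
  anchor D v (fun y => f y + g y) = anchor D v f + anchor D v g.
Proof.
move=> sf sg; have := anchor_linf ax v 1 sf sg; rewrite mul1r => <-.
by congr anchor; apply/funext => y; rewrite mul1r.
Qed.

(** The Leibniz rule for 1 = 1 . 1 gives the constant 1. *)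
Lemma anchor_cst x (v : A x) (c : R) : anchor D v (fun=> c) = 0.
Proof.
have s1 := smooth_cst (M := M) 1.
have a1 : anchor D v (fun=> 1) = 0.
  by have := anchor_der ax v s1 s1; rewrite !mul1r; move: (anchor _ _ _) => w; lra.
have a0 : anchor D v (fun=> 0) = 0.
  by have := anchor_linf ax v (-1) s1 s1; rewrite a1 !mulr0 addr0 mulr1 addNr.
by have := anchor_linf ax v c s1 (smooth_cst 0); rewrite a1 a0 !mulr0 !addr0 mulr1.
Qed.

Lemma anchorN x (v : A x) f : smooth f ->
  anchor D v (fun y => - f y) = - anchor D v f.
Proof.
move=> sf; have := anchor_linf ax v (-1) sf (smooth_cst 0).
rewrite anchor_cst mulN1r addr0 => <-.
by congr anchor; apply/funext => y; rewrite mulN1r addr0.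
Qed.

Lemma anchorB x (v : A x) f g : smooth f -> smooth g ->
  anchor D v (fun y => f y - g y) = anchor D v f - anchor D v g.
Proof.
by move=> sf sg; rewrite anchorD ?anchorN//; exact: smooth_opp.
Qed.

Lemma anchor_vec0 x f : smooth f -> anchor D (0 : A x) f = 0.
Proof.
move=> sf; have := anchor_lin ax (-1) (0 : A x) 0 sf.
by rewrite scaler0 addr0 mulN1r addNr.
Qed.

Lemma anchor_vecZ x (c : R) (u : A x) f : smooth f ->
  anchor D (c *: u) f = c * anchor D u f.
Proof.
by move=> sf; rewrite -(addr0 (c *: u)) (anchor_lin ax)// anchor_vec0// addr0.
Qed.

Lemma bracket_linr f X Y Z x : smooth f ->
  smooth_section X -> smooth_section Y -> smooth_section Z ->
  bracket D X (fun y => f y *: Y y + Z y) x =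
  f x *: bracket D X Y x + anchor D (X x) f *: Y x + bracket D X Z x.
Proof.
move=> sf sX sY sZ; have sfY := smooth_section_scale sf sY.
rewrite (bracket_skew ax)//; last exact: smooth_section_add.
have -> : (fun y => f y *: Y y + Z y) = (fun y => 1 *: (f y *: Y y) + Z y).
  by apply: functional_extensionality_dep => y; rewrite scale1r.
rewrite (bracket_lin ax)// scale1r opprD -!(bracket_skew ax)//.
by rewrite (bracket_leibniz ax).
Qed.

Lemma dform_skew al X Y x : smooth_section X -> smooth_section Y ->
  dform D al X Y x = - dform D al Y X x.
Proof.
by move=> sX sY; rewrite /dform (bracket_skew ax sX sY) covecN; ring.
Qed.

(** Tensoriality of d al: the derivative of f produced by the anchor cancels the one produced by the
    Leibniz rule of the bracket. *)
Lemma dform_linr al f X Y Z x : smooth_cosection al -> smooth f ->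
  smooth_section X -> smooth_section Y -> smooth_section Z ->
  dform D al X (fun y => f y *: Y y + Z y) x =
  f x * dform D al X Y x + dform D al X Z x.
Proof.
move=> sal sf sX sY sZ; rewrite /dform bracket_linr//.
have -> : (fun y => al y (f y *: Y y + Z y)) = (fun y => f y * al y (Y y) + al y (Z y)).
  by apply/funext => y; rewrite covecDr.
have [saY saZ] := (sal _ sY, sal _ sZ).
rewrite anchorD//; last exact: smooth_mul.
rewrite (anchor_der ax)// (anchor_lin ax)//; last exact: sal.
by rewrite !covecD !covecZ; ring.
Qed.

Lemma dform_linl al f X Y Z x : smooth_cosection al -> smooth f ->
  smooth_section X -> smooth_section Y -> smooth_section Z ->
  dform D al (fun y => f y *: Y y + Z y) X x =
  f x * dform D al Y X x + dform D al Z X x.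
Proof.
move=> sal sf sX sY sZ; rewrite dform_skew//; last first.
  by apply: smooth_section_add => //; exact: smooth_section_scale.
rewrite dform_linr// (dform_skew al x sX sY) (dform_skew al x sX sZ); ring.
Qed.

Lemma dform_scaler al f X Y x : smooth_cosection al -> smooth f ->
  smooth_section X -> smooth_section Y ->
  dform D al X (fun y => f y *: Y y) x = f x * dform D al X Y x.
Proof.
move=> sal sf sX sY; rewrite /dform (bracket_leibniz ax)//.
have -> : (fun y => al y (f y *: Y y)) = (fun y => f y * al y (Y y)).
  by apply/funext => y; rewrite covecZ.
have [saX saY] := (sal _ sX, sal _ sY).
by rewrite (anchor_der ax)// anchor_vecZ// !covecD !covecZ; ring.
Qed.

Lemma dform_scalel al f X Y x : smooth_cosection al -> smooth f ->
  smooth_section X -> smooth_section Y ->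
  dform D al (fun y => f y *: Y y) X x = f x * dform D al Y X x.
Proof.
move=> sal sf sX sY; rewrite dform_skew//; last exact: smooth_section_scale.
by rewrite dform_scaler// (dform_skew al x sX sY); ring.
Qed.

Lemma dform_sharp P al be X x : pvfield 2 P -> smooth_section X ->
  smooth_cosection al -> smooth_cosection be ->
  dform D be (sharp_field P al) X x =
  anchor D (sharp_field P al x) (fun y => be y (X y))
  - anchor D (X x) (fun y => P y [:: al y; be y])
  + be x (bracket D X (sharp_field P al) x).
Proof.
move=> hP sX sal sbe; rewrite /dform (bracket_skew ax)//; last exact: smooth_sharp.
rewrite covecN opprK; congr (_ - anchor D _ _ + _).
by apply/funext => y; rewrite (sharpE (hP.1 y)).
Qed.

Lemma anchor_biv_skew P al be x (v : A x) : pvfield 2 P ->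
  smooth_cosection al -> smooth_cosection be ->
  anchor D v (fun y => P y [:: al y; be y]) =
  - anchor D v (fun y => P y [:: be y; al y]).
Proof.
move=> hP sal sbe; rewrite -anchorN; last exact: pvfield_smooth.
by congr anchor; apply/funext => y; rewrite (biv_skew (hP.1 y)).
Qed.

Lemma sharp_field_comb f P Q al : pvfield 2 P -> pvfield 2 Q ->
  sharp_field (fun x s => f x * P x s + Q x s) al =
  (fun y => f y *: sharp_field P al y + sharp_field Q al y).
Proof.
move=> hP hQ; apply: functional_extensionality_dep => y; apply: covec_inj => b.
have hPQ : pvector 2 (fun s => f y * P y s + Q y s).
  apply: pvector2 => [s hs|k a c d|a c].
  - by rewrite (pvector_size (hP.1 y))// (pvector_size (hQ.1 y))// mulr0 addr0.
  - by rewrite (bivDl (hP.1 y)) (bivDl (hQ.1 y)); ring.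
  - by rewrite (biv_skew (hP.1 y)) (biv_skew (hQ.1 y)); ring.
by rewrite covecDr (sharpE hPQ) (sharpE (hP.1 y)) (sharpE (hQ.1 y)).
Qed.

(** The right-hand side has the shape f Y + Z to which [bracket_linr], [dform_linr] and [dform_linl]
    apply. *)
Lemma sharp_field_wedge X Y al : smooth_section X -> smooth_section Y ->
  sharp_field (fun x => wedge (mv_of_section X x) (mv_of_section Y x)) al =
  (fun y => al y (X y) *: Y y + (- al y (Y y)) *: X y).
Proof.
move=> sX sY; apply: functional_extensionality_dep => y; apply: covec_inj => b.
rewrite /sharp_field sharpE ?wedge_sections; last exact: (pvfield_wedge sX sY).1.
by rewrite covecDr covecZ; ring.
Qed.

Section Schouten.
Context (sch : mvfield A -> mvfield A -> mvfield A) (hS : is_schouten D sch).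
Arguments sch : clear implicits.

(** f Q is the wedge product of f and Q, so the Leibniz rule applies; its sign is +1 because f has
    degree 0. *)
Lemma sch_comb p P f Q S x s : pvfield p P -> smooth f -> pvfield 2 Q ->
  pvfield 2 S ->
  sch P (fun y t => f y * Q y t + S y t) x s =
  wedge (sch P (mv_of_fun A f) x) (Q x) s
  + wedge (mv_of_fun A f x) (sch P Q x) s + sch P S x s.
Proof.
move=> hP sf hQ hSS; have hf := pvfield_fun (A := A) sf.
have E : (fun y t => f y * Q y t) = (fun y => wedge (mv_of_fun A f y) (Q y)).
  apply: functional_extensionality_dep => y; apply/funext => t.
  have [t2|t2] := eqVneq (size t) 2; last first.
    by rewrite (wedge_size (hf.1 y) (hQ.1 y))// (pvector_size (hQ.1 y))// mulr0.
  case: t t2 => [//|a [//|b [|//]]] _; rewrite wedge2 /=; ring.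
have hfQ := pvfield_scale sf hQ.
have -> : (fun y t => f y * Q y t + S y t) =
    (fun y t => 1 * (fun y t => f y * Q y t) y t + S y t).
  by apply: functional_extensionality_dep => y; apply/funext => t; rewrite mul1r.
rewrite (sch_lin hS 1 hP hfQ hSS) mul1r E (sch_leibniz hS hP hf hQ).
by rewrite muln0 expr0 mul1r.
Qed.

(** Both sides are linear in Q over functions, since [f, g] = 0, and they agree on X /\ Y by [f, X]
    = - rho(X) f. *)
Lemma sch_fun_bivector f Q x b : smooth f -> pvfield 2 Q ->
  sch (mv_of_fun A f) Q x [:: b] = anchor D (sharp (Q x) b) f.
Proof.
move=> sf; have hf := pvfield_fun (A := A) sf.
have [be sbe <-] := ex_smooth_cosection b.
suff H P : pvfield 2 P -> sch (mv_of_fun A f) P x [:: be x]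
    - anchor D (sharp_field P be x) f = 0.
  by move=> /H/eqP; rewrite subr_eq0 => /eqP.
move: P; apply: (bivector_eq0 (x0 := x)) => [g P P' sg hP hP'|X Y sX sY].
  rewrite (sch_comb _ hf sg hP hP') !wedge1 /= !(sch_fun_fun hS)//.
  by rewrite sharp_field_comb// (anchor_lin ax)//; ring.
rewrite (sch_leibniz hS hf (pvfield_section sX) (pvfield_section sY)).
rewrite sharp_field_wedge// (anchor_lin ax)// anchor_vecZ//.
rewrite !wedge1 /= !(sch_skew hS hf (pvfield_section _))//.
rewrite !(sch_section_fun hS)//= expr2 expr1; ring.
Qed.

(** The Lie derivative (L_X Q)(al, be), with L_X al and L_X be written out through the bracket. *)
Definition lie_bivector X Q al be x : R :=
  be x (bracket D X (sharp_field Q al) x) - al x (bracket D X (sharp_field Q be) x)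
  - anchor D (X x) (fun y => Q y [:: al y; be y]).

(** Both sides deviate from linearity over functions in Q by the same term (rho(X) f) Q(al, be), so
    their difference is tensorial. *)
Lemma sch_section_bivector X Q al be x : smooth_section X -> pvfield 2 Q ->
  smooth_cosection al -> smooth_cosection be ->
  sch (mv_of_section X) Q x [:: al x; be x] = lie_bivector X Q al be x.
Proof.
move=> sX hQ sal sbe; have hX := pvfield_section sX.
suff H P : pvfield 2 P -> sch (mv_of_section X) P x [:: al x; be x]
    - lie_bivector X P al be x = 0.
  by move: hQ => /H/eqP; rewrite subr_eq0 => /eqP.
move: P; apply: (bivector_eq0 (x0 := x)) => [g P P' sg hP hP'|Y Z sY sZ].
  have sP := pvfield_smooth hP sal sbe; have sP' := pvfield_smooth hP' sal sbe.
  rewrite (sch_comb _ hX sg hP hP') !wedge2 /= !(sch_section_fun hS)//=.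
  rewrite /lie_bivector !sharp_field_comb// !bracket_linr//; try exact: smooth_sharp.
  rewrite anchorD//; last exact: smooth_mul.
  rewrite (anchor_der ax)// !covecD !covecZ /sharp_field.
  rewrite !(sharpE (hP.1 x)) (biv_skew (hP.1 x) (be x)); ring.
have [[saY saZ] [sbY sbZ]] := ((sal _ sY, sal _ sZ), (sbe _ sY, sbe _ sZ)).
rewrite (sch_leibniz hS hX (pvfield_section sY) (pvfield_section sZ)).
rewrite !wedge2 /= !(sch_section_section hS)//=.
rewrite /lie_bivector !sharp_field_wedge//.
have sZ' u : smooth_cosection u ->
    smooth_section (fun y => (- u y (Z y)) *: Y y : A y).
  by move=> su; apply: smooth_section_scale => //; exact: smooth_opp (su _ sZ).
rewrite !bracket_linr ?(bracket_leibniz ax)//; try exact: sZ'; try exact: smooth_opp.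
have -> : (fun y => wedge (mv_of_section Y y) (mv_of_section Z y) [:: al y; be y]) =
    (fun y => al y (Y y) * be y (Z y) - be y (Y y) * al y (Z y)).
  by apply/funext => y; rewrite wedge_sections.
rewrite anchorB ?(anchor_der ax) ?anchorN//; try exact: smooth_mul.
by rewrite !covecD !covecZ; ring.
Qed.

(* One cyclic summand of the value of [P, Q] on three cosections. *)
Definition sch_term P Q al be ga x : R :=
  anchor D (sharp_field P al x) (fun y => Q y [:: be y; ga y])
  + anchor D (sharp_field Q al x) (fun y => P y [:: be y; ga y])
  - dform D ga (sharp_field P al) (sharp_field Q be) x
  - dform D ga (sharp_field Q al) (sharp_field P be) x.

(** The last term is the deviation from linearity over functions; its cyclic sum is ([P, f] /\
    Q)(al, be, ga). *)
Lemma sch_term_comb f P Q S al be ga x : smooth f ->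
  pvfield 2 P -> pvfield 2 Q -> pvfield 2 S ->
  smooth_cosection al -> smooth_cosection be -> smooth_cosection ga ->
  sch_term P (fun y s => f y * Q y s + S y s) al be ga x =
  f x * sch_term P Q al be ga x + sch_term P S al be ga x
  + anchor D (sharp_field P al x) f * Q x [:: be x; ga x].
Proof.
move=> sf hP hQ hSS sal sbe sga; rewrite /sch_term !sharp_field_comb//.
have sQ := pvfield_smooth hQ sbe sga; have sS := pvfield_smooth hSS sbe sga.
rewrite dform_linr ?dform_linl//; try exact: smooth_sharp.
rewrite anchorD//; last exact: smooth_mul.
rewrite (anchor_der ax)// (anchor_lin ax) //; last exact: pvfield_smooth.
by ring.
Qed.

(** Arranged so that the cyclic sum is ([P, X] /\ Y - X /\ [P, Y])(al, be, ga). *)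
Lemma sch_term_wedge P X Y al be ga x : pvfield 2 P ->
  smooth_section X -> smooth_section Y ->
  smooth_cosection al -> smooth_cosection be -> smooth_cosection ga ->
  sch_term P (fun x => wedge (mv_of_section X x) (mv_of_section Y x)) al be ga x =
  ga x (Y x) * anchor D (sharp_field P al x) (fun y => be y (X y))
  - ga x (X x) * anchor D (sharp_field P al x) (fun y => be y (Y y))
  + be x (X x) * (anchor D (Y x) (fun y => P y [:: al y; ga y])
                  - ga x (bracket D Y (sharp_field P al) x))
  - be x (Y x) * (anchor D (X x) (fun y => P y [:: al y; ga y])
                  - ga x (bracket D X (sharp_field P al) x))
  + al x (X x) * (anchor D (sharp_field P be x) (fun y => ga y (Y y))
                  + ga x (bracket D Y (sharp_field P be) x))
  - al x (Y x) * (anchor D (sharp_field P be x) (fun y => ga y (X y))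
                  + ga x (bracket D X (sharp_field P be) x)).
Proof.
move=> hP sX sY sal sbe sga; rewrite /sch_term !sharp_field_wedge//.
have [[saX sbX sgX] [saY sbY sgY]] :=
  (And3 (sal _ sX) (sbe _ sX) (sga _ sX), And3 (sal _ sY) (sbe _ sY) (sga _ sY)).
have [naY nbY] := (smooth_opp saY, smooth_opp sbY).
have [sPa sPb] := (smooth_sharp hP sal, smooth_sharp hP sbe).
have sX' u : smooth_cosection u ->
    smooth_section (fun y => (- u y (Y y)) *: X y : A y).
  by move=> su; apply: smooth_section_scale => //; exact: smooth_opp (su _ sY).
rewrite !dform_linr ?dform_scaler ?dform_linl ?dform_scalel//; try exact: sX'.
rewrite (dform_skew ga x sX sPb) (dform_skew ga x sY sPb) !dform_sharp//.
rewrite (anchor_lin ax) ?anchor_vecZ//; try exact: pvfield_smooth.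
have -> : (fun y => wedge (mv_of_section X y) (mv_of_section Y y) [:: be y; ga y]) =
    (fun y => be y (X y) * ga y (Y y) - ga y (X y) * be y (Y y)).
  by apply/funext => y; rewrite wedge_sections.
rewrite anchorB; try exact: smooth_mul.
rewrite !(anchor_der ax)//; ring.
Qed.

Lemma sch_bivector_section P X al be x : pvfield 2 P -> smooth_section X ->
  smooth_cosection al -> smooth_cosection be ->
  sch P (mv_of_section X) x [:: al x; be x] = - lie_bivector X P al be x.
Proof.
move=> hP sX sal sbe; rewrite (sch_skew hS hP (pvfield_section sX)).
by rewrite sch_section_bivector//; ring.
Qed.

Lemma sch_bivector_bivector P Q al be ga x : pvfield 2 P -> pvfield 2 Q ->
  smooth_cosection al -> smooth_cosection be -> smooth_cosection ga ->
  sch P Q x [:: al x; be x; ga x] =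
  sch_term P Q al be ga x + sch_term P Q be ga al x + sch_term P Q ga al be x.
Proof.
move=> hP hQ sal sbe sga.
suff H S : pvfield 2 S -> sch P S x [:: al x; be x; ga x]
    - (sch_term P S al be ga x + sch_term P S be ga al x + sch_term P S ga al be x) = 0.
  by move: hQ => /H/eqP; rewrite subr_eq0 => /eqP.
move: S; apply: (bivector_eq0 (x0 := x)) => [g S S' sg hSS hS'|X Y sX sY].
  rewrite (sch_comb _ hP sg hSS hS') !wedge3 /= !sch_term_comb//.
  have hf := pvfield_fun (A := A) sg.
  have -> : sch P (mv_of_fun A g) x [::] = 0.
    by rewrite (pvector_size ((sch_degree hS hP hf isT).1 x)).
  (* In these degrees [P, f] = [f, P], whose value on b is rho(P b) f. *)
  rewrite !(sch_skew hS hP hf) !sch_fun_bivector//.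
  rewrite (pvector_size (hSS.1 x) (s := [:: _; _; _]))//.
  rewrite !(pvector_size (hSS.1 x) (s := [:: _]))//.
  rewrite (pvector_size (hSS.1 x) (s := [::]))//.
  rewrite (biv_skew (hSS.1 x) (al x) (ga x)) /sharp_field; ring.
rewrite (sch_leibniz hS hP (pvfield_section sX) (pvfield_section sY)).
rewrite !wedge3 /= !sch_bivector_section// !sch_term_wedge// /lie_bivector.
have [sPa [sPb sPg]] := (smooth_sharp hP sal, (smooth_sharp hP sbe, smooth_sharp hP sga)).
rewrite !(anchor_biv_skew _ hP sal sga) !(anchor_biv_skew _ hP sbe sal).
rewrite !(anchor_biv_skew _ hP sga sbe).
ring.
Qed.

End Schouten.
End Calculus.

(** * The concomitant of two bivector fields *)

Section Concomitant.
Context {R : realType} {n r : nat} {M : manifold R n} {A : vbundle M r}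
  (D : lie_algebroid A) (phi : cosection A).
Implicit Types (X Y Z : section A) (al be ga : cosection A) (P Q : mvfield A).
Let ax := la_axioms D.

(** The two Lie derivatives contribute d^phi(Q(al, be)) twice, and the last term of the bracket
    removes one copy. Bare algebroid data allow the use for both D and its deformation. *)
Lemma bivector_bracketE (E : algebroid_data A) (psi : cosection A) Q al be Z x :
  (forall x (v : A x) f, smooth f -> anchor E v (fun y => - f y) = - anchor E v f) ->
  pvfield 2 Q -> smooth_cosection al -> smooth_cosection be ->
  bivector_bracket E psi Q al be Z x =
  dphi_form E psi be (sharp_field Q al) Z x
  - dphi_form E psi al (sharp_field Q be) Z x
  + dphi_fun E psi (fun y => Q y [:: al y; be y]) Z x.
Proof.
move=> EN hQ sal sbe; rewrite /bivector_bracket /lie_phi.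
have -> : (fun y => be y (sharp_field Q al y)) = (fun y => Q y [:: al y; be y]).
  by apply/funext => y; rewrite (sharpE (hQ.1 y)).
have -> : (fun y => al y (sharp_field Q be y)) = (fun y => - Q y [:: al y; be y]).
  by apply/funext => y; rewrite (sharpE (hQ.1 y)) (biv_skew (hQ.1 y)).
rewrite /dphi_fun /dfun EN; last exact: pvfield_smooth.
by ring.
Qed.

(** For P = Q this is twice the pairing of ga with [P al, P be] - P [al, be]_P, the defect of P as a
    morphism of brackets. *)
Definition concomitant P Q al be ga x : R :=
  bivector_bracket D phi Q al be (sharp_field P ga) x
  + bivector_bracket D phi P al be (sharp_field Q ga) x
  + ga x (bracket D (sharp_field P al) (sharp_field Q be) x)
  + ga x (bracket D (sharp_field Q al) (sharp_field P be) x).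

Lemma schouten_jacobiE (sch : mvfield A -> mvfield A -> mvfield A)
    P Q al be ga (x : M) : is_schouten D sch ->
  pvfield 2 P -> pvfield 2 Q ->
  smooth_cosection al -> smooth_cosection be -> smooth_cosection ga ->
  schouten_jacobi sch phi 2 2 P Q x [:: al x; be x; ga x] =
  concomitant P Q al be ga x.
Proof.
move=> hS hP hQ sal sbe sga; have [hPx hQx] := (hP.1 x, hQ.1 x).
rewrite /schouten_jacobi (sch_bivector_bivector hS _ hP hQ sal sbe sga).
rewrite !wedge3 /iprod.
rewrite !(pvector_size hPx (s := [:: _; _; _]))// !(pvector_size hPx (s := [:: _]))//.
rewrite (pvector_size hPx (s := [::]))//.
rewrite !(pvector_size hQx (s := [:: _; _; _]))// !(pvector_size hQx (s := [:: _]))//.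
rewrite (pvector_size hQx (s := [::]))//.
rewrite (pvector_size hPx (s := [:: _; _; _; _]))//.
rewrite (pvector_size hQx (s := [:: _; _; _; _]))//.
have EN x' (v : A x') f : smooth f -> anchor D v (fun y => - f y) = - anchor D v f.
  exact: anchorN.
rewrite /concomitant !bivector_bracketE// /sch_term.
have [[sPa sPb sPg] [sQa sQb sQg]] :=
  (And3 (smooth_sharp hP sal) (smooth_sharp hP sbe) (smooth_sharp hP sga),
   And3 (smooth_sharp hQ sal) (smooth_sharp hQ sbe) (smooth_sharp hQ sga)).
rewrite /dphi_form /dphi_fun /dfun.
rewrite (dform_skew D be x sQa sPg) (dform_skew D be x sPa sQg).
(* The formula for d ga, solved for the bracket; it brings in the anchor and differential terms of
   [sch_term]. *)
have Eg S S' : pvfield 2 S -> pvfield 2 S' ->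
    ga x (bracket D (sharp_field S al) (sharp_field S' be) x) =
    anchor D (sharp_field S al x) (fun y => S' y [:: be y; ga y])
    + anchor D (sharp_field S' be x) (fun y => S y [:: ga y; al y])
    - dform D ga (sharp_field S al) (sharp_field S' be) x.
  move=> hS1 hS2; rewrite /dform.
  have -> : (fun y => ga y (sharp_field S' be y)) = (fun y => S' y [:: be y; ga y]).
    by apply/funext => y; rewrite (sharpE (hS2.1 y)).
  have -> : (fun y => ga y (sharp_field S al y)) = (fun y => S y [:: al y; ga y]).
    by apply/funext => y; rewrite (sharpE (hS1.1 y)).
  by rewrite (anchor_biv_skew D _ hS1 sal sga); ring.
rewrite !Eg//.
rewrite /sharp_field !(sharpE hPx) !(sharpE hQx).
(* A fixed order of arguments lets [ring] match the terms in phi with P /\ i_phi Q + i_phi P /\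
   Q. *)
rewrite !(biv_skew hPx (phi x)) !(biv_skew hQx (phi x)).
rewrite !(biv_skew hPx (be x) (al x)) !(biv_skew hQx (be x) (al x)).
rewrite !(biv_skew hPx (ga x) (be x)) !(biv_skew hQx (ga x) (be x)).
rewrite !(biv_skew hPx (al x) (ga x)) !(biv_skew hQx (al x) (ga x)).
ring.
Qed.

End Concomitant.

(** * The hierarchy *)

Section Iterates.
Context {R : realType} {n r : nat} {M : manifold R n} {A : vbundle M r}.
Variables (P : mvfield A) (N : endo A).
Arguments P : clear implicits.
Hypotheses (hP : pvfield 2 P) (sN : smooth_endo N).
Hypothesis NP : forall x (a : 'Hom(A x, R^o)),
  N x (sharp (P x) a) = sharp (P x) (a \o N x)%VF.
Implicit Types (al be ga : cosection A) (k : nat).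

(** As N^k P = P N*^k on covectors, b(N^k P a) = - (N*^k a)(P b) = - a(N^k P b). *)
Lemma iter_sharp_skew k x (a b : 'Hom(A x, R^o)) :
  b (iter k (N x) (sharp (P x) a)) = - a (iter k (N x) (sharp (P x) b)).
Proof.
pose Nt (u : 'Hom(A x, R^o)) : 'Hom(A x, R^o) := (u \o N x)%VF.
have sharpNt j u : iter j (N x) (sharp (P x) u) = sharp (P x) (iter j Nt u).
  by elim: j => [//|j IH]; rewrite iterS IH NP.
have NtE j u v : iter j Nt u v = u (iter j (N x) v).
  by elim: j v => [//|j IH] v; rewrite iterS iterSr -IH comp_lfunE.
by rewrite [in LHS]sharpNt (sharp_skew (hP.1 x)) NtE.
Qed.

Lemma pvector_iter k x : pvector 2 (iter_bivector N k P x).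
Proof.
apply: pvector2 => [[|a [|b [|c s]]]//|k' a b c|a b].
(* Skew-symmetry moves the first argument to the place where linearity is evident. *)
- by rewrite /= !(iter_sharp_skew k _ c) covecDl opprD mulrN.
- exact: iter_sharp_skew.
Qed.

Lemma sharp_iter k x a :
  sharp (iter_bivector N k P x) a = iter k (N x) (sharp (P x) a).
Proof. by apply: covec_inj => b; rewrite (sharpE (pvector_iter k x)). Qed.

Lemma pvfield_iter k : pvfield 2 (iter_bivector N k P).
Proof.
apply: pvfield2P => [x|al be sal sbe]; first exact: pvector_iter.
apply: (sbe (fun x => iter k (N x) (sharp (P x) (al x)) : A x)).
elim: k => [|k IH]; first exact: smooth_sharp.
exact: sN IH.
Qed.

(** Together with [sharp_iter_coapp]: N on the left and N* on the right both raise k by one. *)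
Lemma endo_sharp_iter k al :
  app_endo N (sharp_field (iter_bivector N k P) al) =
  sharp_field (iter_bivector N k.+1 P) al.
Proof.
apply: functional_extensionality_dep => x.
by rewrite /app_endo /sharp_field !sharp_iter.
Qed.

Lemma sharp_iter_coapp k al :
  sharp_field (iter_bivector N k P) (coapp_endo N al) =
  sharp_field (iter_bivector N k.+1 P) al.
Proof.
apply: functional_extensionality_dep => x.
by rewrite /sharp_field !sharp_iter /coapp_endo -NP iterSr.
Qed.

Lemma iter_coappl k al be :
  (fun x => iter_bivector N k P x [:: coapp_endo N al x; be x]) =
  (fun x => iter_bivector N k.+1 P x [:: al x; be x]).
Proof. by apply/funext => x; rewrite /= /coapp_endo -NP -iterSr. Qed.

Lemma iter_coappr k al be :
  (fun x => iter_bivector N k P x [:: al x; coapp_endo N be x]) =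
  (fun x => iter_bivector N k.+1 P x [:: al x; be x]).
Proof. by apply/funext => x; rewrite /= comp_lfunE. Qed.

Lemma iter_bivector0 : iter_bivector N 0 P = P.
Proof.
apply: functional_extensionality_dep => x; apply/funext => s.
have [s2|s2] := eqVneq (size s) 2; last first.
  by rewrite (pvector_size (pvector_iter 0 x))// (pvector_size (hP.1 x)).
by case: s s2 => [//|a [//|b [|//]]] _ /=; rewrite (sharpE (hP.1 x)).
Qed.

End Iterates.

(** * Differential calculus of the deformed algebroid *)

Section Deformation.
Context {R : realType} {n r : nat} {M : manifold R n} {A : vbundle M r}
  (D : lie_algebroid A) (phi : cosection A) (N : endo A).
Implicit Types (X Y : section A) (al be : cosection A).

Lemma coapp_endoE al X :
  (fun x => coapp_endo N al x (X x)) = (fun x => al x (app_endo N X x)).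
Proof. by apply/funext => x; rewrite comp_lfunE. Qed.

(** The deformed differential is the commutator of d^phi with the insertion of N; the phi terms fit
    because the deformed cocycle is N* phi. *)
Lemma dphi_form_deformed al X Y x :
  dphi_form (deformed D N) (coapp_endo N phi) al X Y x =
  dphi_form D phi al (app_endo N X) Y x + dphi_form D phi al X (app_endo N Y) x
  - dphi_form D phi (coapp_endo N al) X Y x.
Proof.
rewrite /dphi_form /dform /deformed /= !coapp_endoE /coapp_endo.
rewrite !comp_lfunE !covecB !covecD /app_endo; ring.
Qed.

(* As N is torsion-free, the differential of the deformed algebroid maps the
   pullback of al to the pullback of the differential of al. *)
Lemma dphi_form_nijenhuis al X Y x : is_nijenhuis D N ->
  smooth_section X -> smooth_section Y ->
  dphi_form D phi (coapp_endo N (coapp_endo N al)) X Y x =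
  dphi_form D phi (coapp_endo N al) (app_endo N X) Y x
  + dphi_form D phi (coapp_endo N al) X (app_endo N Y) x
  - dphi_form D phi al (app_endo N X) (app_endo N Y) x.
Proof.
move=> [_ hN] sX sY; have := hN _ _ sX sY x => /= hNXY.
rewrite /dphi_form /dform !coapp_endoE hNXY /coapp_endo /=.
rewrite !comp_lfunE !(linearB, linearD) /app_endo /=; ring.
Qed.

End Deformation.

(** * Brackets and concomitants along the hierarchy *)

Section Hierarchy.
Context {R : realType} {n r : nat} {M : manifold R n} {A : vbundle M r}
  (D : lie_algebroid A) (phi : cosection A) (P : mvfield A) (N : endo A).
Arguments P : clear implicits.
Hypotheses (hP : pvfield 2 P) (hN : is_nijenhuis D N).
Hypothesis NP : forall x (a : 'Hom(A x, R^o)),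
  N x (sharp (P x) a) = sharp (P x) (a \o N x)%VF.
Hypothesis bracketNP : forall al be (Z : section A),
  smooth_cosection al -> smooth_cosection be -> smooth_section Z ->
  forall x, bivector_bracket D phi (iter_bivector N 1 P) al be Z x =
    bivector_bracket (deformed D N) (coapp_endo N phi) P al be Z x.
Implicit Types (al be ga : cosection A) (X Y Z : section A).

Local Notation NS k := (iter_bivector N k P).
Local Notation Nt := (coapp_endo N).
Let sN : smooth_endo N := hN.1.
Let hQ k : pvfield 2 (NS k) := pvfield_iter hP sN NP k.

Let sNt al : smooth_cosection al -> smooth_cosection (Nt al).
Proof. exact: smooth_coapp_endo. Qed.

Let bracketE k al be Z x : smooth_cosection al -> smooth_cosection be ->
  bivector_bracket D phi (NS k) al be Z x =
  dphi_form D phi be (sharp_field (NS k) al) Z x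
  - dphi_form D phi al (sharp_field (NS k) be) Z x
  + dphi_fun D phi (fun y => NS k y [:: al y; be y]) Z x.
Proof. by move=> *; apply: bivector_bracketE => // *; exact: anchorN. Qed.

(** The identity for N* [al, be]_(P_k), evaluated on Z; hence N Z in the bracket. *)
Let star k := forall al be Z x,
  smooth_cosection al -> smooth_cosection be -> smooth_section Z ->
  bivector_bracket D phi (NS k) al be (app_endo N Z) x =
  dphi_form D phi (Nt be) (sharp_field (NS k) al) Z x
  - dphi_form D phi (Nt al) (sharp_field (NS k) be) Z x
  + dphi_fun D phi (fun y => NS k.+1 y [:: al y; be y]) Z x.

Lemma bracket_coapp0 : star 0.
Proof.
move=> al be Z x sal sbe sZ; have := bracketNP sal sbe sZ x.
rewrite -{2}(iter_bivector0 hP NP) (bivector_bracketE (E := deformed D N))//; last first.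
  by move=> *; exact: anchorN.
(* The differentials of al and be along NP occur on both sides of the compatibility condition and
   cancel. *)
rewrite !bracketE// !dphi_form_deformed !(endo_sharp_iter hP NP).
by rewrite {2}/dphi_fun /dfun /= comp_lfunE => h; rewrite {1}/dphi_fun /dfun; lra.
Qed.

Lemma bracket_coapp k : star k.
Proof.
elim: k => [|k IH]; first exact: bracket_coapp0.
move=> al be Z x sal sbe sZ.
(* These instances involve P_(k+1), because P_k N* = P_(k+1). Their terms in d(N*^2 al) and d(N*^2
   be) are expanded by vanishing torsion. *)
have := IH _ _ _ x (sNt sal) sbe sZ; have := IH _ _ _ x sal (sNt sbe) sZ.
have [sna snb] := (sNt sal, sNt sbe).
rewrite !bracketE// !iter_coappl// !iter_coappr !(sharp_iter_coapp hP NP).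
have [sPa sPb] := (smooth_sharp (hQ k) sal, smooth_sharp (hQ k) sbe).
rewrite !(dphi_form_nijenhuis _ _ _ hN)// !(endo_sharp_iter hP NP).
lra.
Qed.

(** Once the bracket at N Z is replaced by means of [star k], the terms in d(N* al) and d(N* be)
    cancel. *)
Lemma bracket_iterS k al be Z x :
  smooth_cosection al -> smooth_cosection be -> smooth_section Z ->
  bivector_bracket D phi (NS k.+1) al be Z x =
  bivector_bracket D phi (NS k) (Nt al) be Z x
  + bivector_bracket D phi (NS k) al (Nt be) Z x
  - bivector_bracket D phi (NS k) al be (app_endo N Z) x.
Proof.
move=> sal sbe sZ; have [sna snb] := (sNt sal, sNt sbe).
rewrite bracket_coapp// !bracketE//.
rewrite !iter_coappl// !iter_coappr !(sharp_iter_coapp hP NP); ring.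
Qed.

Local Notation C i j := (concomitant D phi (NS i) (NS j)).

Lemma concomitantC i j al be ga x : C i j al be ga x = C j i al be ga x.
Proof. by rewrite /concomitant; ring. Qed.

(** Use [bracket_iterS] at j with Z = P_i ga and at i with Z = P_j ga: the terms at N Z cancel
    crosswise, since N P_i ga = P_(i+1) ga. *)
Lemma concomitant_shift i j al be ga x :
  smooth_cosection al -> smooth_cosection be -> smooth_cosection ga ->
  C i.+1 j al be ga x + C i j.+1 al be ga x =
  C i j (Nt al) be ga x + C i j al (Nt be) ga x.
Proof.
move=> sal sbe sga; rewrite /concomitant.
have [sPi sPj] := (smooth_sharp (hQ i) sga, smooth_sharp (hQ j) sga).
rewrite (bracket_iterS j x sal sbe sPi) (bracket_iterS i x sal sbe sPj).
rewrite !(endo_sharp_iter hP NP) !(sharp_iter_coapp hP NP); ring.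
Qed.

(** The brackets of covectors match identically by P_k N* = P_(k+1); the brackets of sections obey
    the relation because N is torsion-free. *)
Lemma concomitant_nijenhuis i j al be ga x :
  smooth_cosection al -> smooth_cosection be -> smooth_cosection ga ->
  C i.+1 j.+1 al be ga x =
  C i.+1 j al be (Nt ga) x + C i j.+1 al be (Nt ga) x
  - C i j al be (Nt (Nt ga)) x.
Proof.
move=> sal sbe sga; rewrite /concomitant !(sharp_iter_coapp hP NP).
have br u v : smooth_section u -> smooth_section v ->
    ga x (bracket D (app_endo N u) (app_endo N v) x) =
    Nt ga x (bracket D (app_endo N u) v x) + Nt ga x (bracket D u (app_endo N v) x)
    - Nt (Nt ga) x (bracket D u v x).
  move=> su sv; rewrite (hN.2 _ _ su sv) /= /coapp_endo !comp_lfunE.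
  by rewrite !(linearB, linearD).
have s k u : smooth_cosection u -> smooth_section (sharp_field (NS k) u).
  exact: smooth_sharp (hQ k).
have := br _ _ (s i _ sal) (s j _ sbe); have := br _ _ (s j _ sal) (s i _ sbe).
rewrite !(endo_sharp_iter hP NP) => -> ->; ring.
Qed.

(** Given the vanishing for smaller i + j, neighbours on an antidiagonal are opposite ([shift]),
    entries with both indices positive vanish ([inner]), and the extreme entries follow ([ends]). *)
Lemma concomitant_eq0 :
  (forall al be ga x, smooth_cosection al -> smooth_cosection be ->
     smooth_cosection ga -> C 0 0 al be ga x = 0) ->
  forall i j al be ga x, smooth_cosection al -> smooth_cosection be ->
     smooth_cosection ga -> C i j al be ga x = 0.
Proof.
move=> C00 i j; have [m] := ubnP (i + j); elim: m i j => [//|m IH] i j ijm.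
move=> al be ga x sal sbe sga.
have [[sna snb] sng] := ((sNt sal, sNt sbe), sNt sga).
have snng := sNt sng.
have shift i' j' : (i' + j' < m)%N ->
    C i'.+1 j' al be ga x = - C i' j'.+1 al be ga x.
  move=> h; apply/eqP; rewrite -addr_eq0 concomitant_shift//.
  by rewrite !IH ?addr0.
have inner i' j' : (i'.+1 + j' < m)%N -> C i'.+1 j'.+1 al be ga x = 0.
  move=> h; rewrite concomitant_nijenhuis// !IH ?addr0 ?subr0//.
    by rewrite (leq_ltn_trans _ h)// addSn.
  by rewrite addnS -addSn.
(* For k = 0 symmetry gives T_10 = - T_01 = - T_10; for larger k the entry is minus an inner one. *)
have ends k : (k < m)%N -> C k.+1 0 al be ga x = 0.
  case: k => [|k] km.
    by have := shift 0 0 km; rewrite (concomitantC 0 1); move: (C 1 0 _ _ _ _) => w; lra.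
  by rewrite shift ?addn0// inner ?oppr0// addn0.
case: i j ijm => [|i] [|j] ijm; first exact: C00.
- by rewrite concomitantC ends.
- by rewrite ends// -(addn0 i).
- by apply: inner; move: ijm; rewrite addnS ltnS.
Qed.

End Hierarchy.

(** * Compatibility as vanishing of the concomitant *)

Lemma pvector_iprod (R : realType) (V : vectType R) p (P : mvec V)
    (a : 'Hom(V, R^o)) : pvector p.+1 P -> pvector p (iprod a P).
Proof.
move=> hP; split=> [s hs|s t c u v|s hs].
- exact: (pvector_size hP).
- exact: (pvector_lin hP (a :: s)).
- by apply: (pvector_alt hP); rewrite /= negb_and hs orbT.
Qed.

(** Covectors at x extend to smooth cosections, which settles lists of length 3; on other lists
    every term vanishes by degree. *)
Lemma compatible_bivectorsP (R : realType) (n r : nat) (M : manifold R n)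
    (A : vbundle M r) (D : lie_algebroid A)
    (sch : mvfield A -> mvfield A -> mvfield A) (phi : cosection A)
    (P Q : mvfield A) :
  is_schouten D sch -> pvfield 2 P -> pvfield 2 Q ->
  compatible_bivectors sch phi P Q <->
  forall (al be ga : cosection A) x, smooth_cosection al ->
    smooth_cosection be -> smooth_cosection ga ->
    concomitant D phi P Q al be ga x = 0.
Proof.
move=> hS hP hQ; split=> [PQ al be ga x sal sbe sga|C0 x s].
  by rewrite -(schouten_jacobiE phi x hS hP hQ sal sbe sga).
have [s3|s3] := eqVneq (size s) 3; last first.
  have [hPx hQx] := (hP.1 x, hQ.1 x).
  rewrite /schouten_jacobi (pvector_size ((sch_degree hS hP hQ isT).1 x))//.
  rewrite (wedge_size hPx (pvector_iprod (phi x) hQx))//.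
  by rewrite (wedge_size (pvector_iprod (phi x) hPx) hQx)// !mulr0 addr0 subr0.
case: s s3 => [//|a [//|b [//|c [|//]]]] _.
have [al sal <-] := ex_smooth_cosection a.
have [be sbe <-] := ex_smooth_cosection b.
have [ga sga <-] := ex_smooth_cosection c.
by rewrite (schouten_jacobiE phi x hS hP hQ sal sbe sga) C0.
Qed.

Theorem proposition6 (R : realType) (n r : nat) (M : manifold R n)
    (A : vbundle M r) (D : lie_algebroid A)
    (sch : mvfield A -> mvfield A -> mvfield A) (phi0 : cosection A)
    (P : mvfield A) (N : endo A) :
  is_schouten D sch ->
  is_jacobi_nijenhuis D sch phi0 P N ->
  (forall k : nat, jacobi_bivector sch phi0 (iter_bivector N k P)) /\
  (forall i j : nat,
     compatible_bivectors sch phi0 (iter_bivector N i P) (iter_bivector N j P)).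
Proof.
move=> hS [_ [hP P0] hN NP hb].
have hQ k := pvfield_iter hP hN.1 NP k.
(* The Jacobi condition for N^k P is its compatibility with itself. *)
suff H i j : compatible_bivectors sch phi0 (iter_bivector N i P) (iter_bivector N j P).
  by split=> // k; split; [exact: hQ|exact: H].
apply/(compatible_bivectorsP phi0 hS (hQ i) (hQ j)).
apply: (concomitant_eq0 hP hN NP hb).
(* Here [P, P]^phi0 = 0 enters, as the vanishing of T_00. *)
by apply/(compatible_bivectorsP phi0 hS (hQ 0) (hQ 0)); rewrite (iter_bivector0 hP NP).
Qed.
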